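(* Let $(a_n)_{n\ge 0}$ be a $2$-Bell sequence, i.e. a sequence satisfying $$a_{n+2}=\sum_{k=0}^n\binom nk 2^{\,n-k}a_k\qquad(n\ge 0),$$ and let $\mathcal A(x)=\sum_{n\ge0}a_n\frac{x^n}{n!}$ be its exponential generating function. Then $\mathcal A(x)=f(e^x)$ where $f$ is a solution of the modified Bessel equation $t^2f''(t)+tf'(t)-t^2f(t)=0$; explicitly, $$\mathcal A(x)=p\,I_0(e^x)+q\,K_0(e^x),$$ with constants $p,q$ uniquely determined by $a_0,a_1$. Specifically: (1) for $(a_0,a_1)=(1,0)$: $p=K_1(1)\approx 0.601907$ and $q=I_1(1)\approx 0.565159$; (2) for $(a_0,a_1)=(0,1)$: $p=K_0(1)\approx 0.421024$ and $q=-I_0(1)\approx -1.266066$; (3) for $(a_0,a_1)=(1,1)$: $p=K_0(1)+K_1(1)\approx 1.022932$ and $q=I_1(1)-I_0(1)\approx -0.700907$.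
   Context: $I_\nu$ and $K_\nu$ are the modified Bessel functions of the first and second kind of order $\nu$, evaluated at positive real arguments ($x$ real). The sequences in (1), (2), (3) are OEIS A351143, A351028 and A007472 respectively. *)

(* Defs.v *)
From Stdlib Require Import Reals Factorial.
From Coquelicot Require Import Coquelicot.
Open Scope R_scope.

(** [Binomial.C n k] is the binomial coefficient; the short name [C] is
    Coquelicot's type of complex numbers. *)
Definition two_bell (a : nat -> R) : Prop :=
  forall n : nat,
    a (S (S n)) = sum_f_R0 (fun k => Binomial.C n k * 2 ^ (n - k) * a k) n.

(** [A] is the exponential generating function of [a], with convergence of the
    series at every real point. *)
Definition is_egf (a : nat -> R) (A : R -> R) : Prop :=
  forall x : R, is_pseries (fun n => a n / INR (fact n)) x (A x).

(** Reciprocal of Euler's Gamma function, by Gauss' limit formula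
    1 / Gamma(z) = lim_n z (z+1) ... (z+n) / (n! n^z).  The limit exists for
    every real [z], and is 0 at the poles 0, -1, -2, ... of Gamma. *)
Definition rgamma (z : R) : R :=
  real (Lim_seq (fun n =>
    prod_f_R0 (fun k => z + INR k) n / (INR (fact n) * Rpower (INR n) z))).

(** I_nu(x) = sum_k (x/2)^(2k+nu) / (k! Gamma(k+nu+1)), for x > 0. *)
Definition besselI (nu x : R) : R :=
  Series (fun k =>
    Rpower (x / 2) (2 * INR k + nu) / INR (fact k) * rgamma (INR k + nu + 1)).

(** K_nu(x) = (pi/2) (I_{-nu}(x) - I_nu(x)) / sin(nu pi) for non-integer nu,
    extended to integer nu by the limit of this quotient as the order tends to
    nu.  The quotient is continuous in the order away from the integers, so the
    limit (which ignores the value at nu) covers both cases. *)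
Definition besselK (nu x : R) : R :=
  real (Lim (fun mu =>
    PI / 2 * ((besselI (- mu) x - besselI mu x) / sin (mu * PI))) nu).

Definition modified_bessel_solution (f : R -> R) : Prop :=
  forall t : R, 0 < t ->
    ex_derive f t /\ ex_derive (Derive f) t /\
    t ^ 2 * Derive (Derive f) t + t * Derive f t - t ^ 2 * f t = 0.

(** The distance is half a unit in the sixth decimal place. *)
Definition approx6 (x y : R) : Prop := Rabs (x - y) <= 5 / 10 ^ 7.

(* Main.v *)
Require Import Defs.
From Stdlib Require Import Reals Factorial Lra Lia.
From Coquelicot Require Import Coquelicot.
Open Scope R_scope.

(** The recurrence says that the exponential generating function [A] satisfies
    [A'' = exp(2x) A]: the right-hand side is the coefficient of a product of
    power series.  The recurrence also forces [a n / n!] to decay faster than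
    any geometric sequence, so [A] is entire ([egf_coef_entire],
    [is_derive_egf_derivative]).  The substitution [t = exp x] turns this
    equation into the modified Bessel equation, so [I_0(exp x)] and
    [K_0(exp x)] are solutions too.  Wronskians of two solutions are constant;
    evaluating those of [A] against both Bessel solutions at [x = 0], and using
    [t (I_0 K_1 + I_1 K_0) = 1], solves for [A] ([egf_eq_bessel]):
    [p = a_0 K_1(1) + a_1 K_0(1)] and [q = a_0 I_1(1) - a_1 I_0(1)].
    The same Wronskian makes the two solutions independent, hence [p] and [q]
    unique.

    What takes work is that [I_nu] is given through the Gauss limit for
    [1/Gamma] and [K_0], [K_1] through limits in the order, so everything above
    depends on closed forms for the latter.  For [nu] near 0 or 1,
    [I_nu(x) = (x/2)^nu rgamma(nu+1) Phi(nu)], where [Phi] is the series with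
    terms [(x/2)^(2k) / (k! (nu+1)...(nu+k))].  Taking logarithms in the Gauss
    product gives [rgamma(1+h) = exp(gamma h + O(h^2))], so the derivative of
    [rgamma] at 1 is Euler's constant ([is_derive_rgamma_1]); [Phi] is
    differentiated termwise with an explicit quadratic remainder
    ([is_derive_hyper01]).  The limit at order 0 is then minus the
    order-derivative of [I].  At order 1 the function [I_(-mu)] is first
    rewritten by the three-term recurrence in the order, so that only orders
    near 0 and 1 occur ([besselK_1_eq]).  With [z = (x/2)^2],
    [S(z) = sum z^k/k!^2] and [T(z) = sum H_k z^k/k!^2] this yields
    [K_0 = T - (ln(x/2) + gamma) S].  From [z S'' + S' = S] and
    [z T'' + T' = T + S'] follow [K_0' = - K_1] and the Wronskian.

    The decimals need Euler's constant to about 1e-8.  It is enclosed by the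
    first terms of the Euler-Maclaurin expansion at [n = 32], where only [ln 2]
    is needed, and [ln 2 = ln(1+1/3) - ln(1-1/3)] is read off the odd Taylor
    polynomial of degree 17. *)

(** * Calculus and power series *)

(** Equalities produced by the normed-module hierarchy carry a carrier type that
    is only convertible to [R], which [ring] and [field] do not recognize. *)
Ltac change_eq_R := match goal with |- ?u = ?v => change (u = v :> R) end.

(** [auto_derive] leaves [Derive (fun y => f y) x] in eta-expanded form, where a
    rewrite by the derivative of [f] fails syntactically. *)
Ltac derive_rewrite H :=
  match type of H with is_derive ?f ?x ?l =>
    replace (Derive (fun y : R => f y) x) with l
      by (symmetry; apply is_derive_unique, H) end.

Lemma INR_S_ge_1 (k : nat) : 1 <= INR (S k).
Proof. apply (le_INR 1). lia. Qed.

Lemma fact_S_INR (k : nat) : INR (fact (S k)) = INR (S k) * INR (fact k).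
Proof. rewrite <- mult_INR. auto. Qed.

Lemma is_lim_seq_inv_INR : is_lim_seq (fun n => / INR n) 0.
Proof.
  replace (Finite 0) with (Rbar_inv p_infty) by reflexivity.
  apply is_lim_seq_inv. apply is_lim_seq_INR. discriminate.
Qed.

Lemma nonneg_of_derive_nonneg (f df : R -> R) (b : R) :
  0 <= b -> f 0 = 0 ->
  (forall t, 0 <= t <= b -> is_derive f t (df t)) ->
  (forall t, 0 <= t <= b -> 0 <= df t) -> 0 <= f b.
Proof.
  intros Hb H0 Hd Hp.
  destruct (MVT_gen f 0 b df) as [c [Hc E]].
  - intros t Ht. rewrite Rmin_left, Rmax_right in Ht by lra. apply Hd; lra.
  - intros t Ht. rewrite Rmin_left, Rmax_right in Ht by lra.
    apply continuity_pt_filterlim, @ex_derive_continuous.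
    eexists. apply Hd; lra.
  - rewrite Rmin_left, Rmax_right in Hc by lra.
    specialize (Hp c Hc). nra.
Qed.

Lemma derive_of_quadratic_bound (f : R -> R) (x l M d : R) :
  0 < d ->
  (forall h, Rabs h <= d -> Rabs (f (x + h) - f x - h * l) <= M * h ^ 2) ->
  is_derive f x l.
Proof.
  intros Hd H. apply is_derive_Reals. intros eps He.
  assert (HM : 0 <= M).
  { specialize (H d). rewrite (Rabs_pos_eq d) in H by lra.
    specialize (H (Rle_refl d)). pose proof (Rabs_pos (f (x + d) - f x - d * l)).
    assert (0 < d ^ 2) by (apply pow_lt; lra). nra. }
  assert (Hm : 0 < Rmin d (eps / (M + 1))).
  { apply Rmin_pos. lra. apply Rdiv_lt_0_compat; lra. }
  exists (mkposreal _ Hm). intros h Hh0 Hh. simpl in Hh.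
  assert (Hh1 : Rabs h < d) by (eapply Rlt_le_trans; [exact Hh | apply Rmin_l]).
  assert (Hh2 : Rabs h < eps / (M + 1))
    by (eapply Rlt_le_trans; [exact Hh | apply Rmin_r]).
  replace ((f (x + h) - f x) / h - l) with ((f (x + h) - f x - h * l) / h)
    by (field; auto).
  unfold Rdiv. rewrite Rabs_mult, Rabs_inv.
  assert (Hp : 0 < Rabs h) by (apply Rabs_pos_lt; auto).
  apply Rmult_lt_reg_r with (Rabs h); auto.
  rewrite Rmult_assoc, Rinv_l, Rmult_1_r by lra.
  eapply Rle_lt_trans. apply H; lra.
  assert (Hh3 : Rabs h * (M + 1) < eps).
  { apply (Rmult_lt_compat_r (M + 1)) in Hh2; [|lra].
    unfold Rdiv in Hh2. rewrite Rmult_assoc, Rinv_l, Rmult_1_r in Hh2; lra. }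
  rewrite <- pow2_abs. nra.
Qed.

Lemma is_derive_0_constant (f : R -> R) : (forall x, is_derive f x 0) ->
  forall x, f x = f 0.
Proof.
  intros H x. destruct (MVT_gen f 0 x (fun _ => 0)) as [c [_ E]].
  - intros; apply H.
  - intros t _. apply continuity_pt_filterlim, @ex_derive_continuous.
    eexists; apply H.
  - lra.
Qed.

Lemma locally_Rabs (x d : R) (P : R -> Prop) : 0 < d ->
  (forall y, Rabs (y - x) < d -> P y) -> locally x P.
Proof. intros Hd H. exists (mkposreal d Hd). intros y Hy. apply H. exact Hy. Qed.

Lemma punctured_Rabs (x d : R) (P : R -> Prop) : 0 < d ->
  (forall y, Rabs (y - x) < d -> y <> x -> P y) -> Rbar_locally' x P.
Proof. intros Hd H. exists (mkposreal d Hd). intros y Hy. apply H. exact Hy. Qed.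

Lemma locally_pos (x : R) (P : R -> Prop) : 0 < x ->
  (forall y, 0 < y -> P y) -> locally x P.
Proof.
  intros Hx H. apply locally_Rabs with x; auto. intros y Hy. apply H.
  apply Rabs_lt_between in Hy. lra.
Qed.

(** L'Hospital's rule at a common simple zero: both difference quotients
    converge, and the common factor [y - x] cancels. *)
Lemma is_lim_quotient_of_derive (f g : R -> R) (x f' g' : R) :
  is_derive f x f' -> is_derive g x g' -> f x = 0 -> g x = 0 -> g' <> 0 ->
  is_lim (fun y => f y / g y) x (f' / g').
Proof.
  assert (Q : forall (u : R -> R) l, is_derive u x l -> u x = 0 ->
    is_lim (fun y => u y / (y - x)) x l).
  { intros u l Hu H0. apply is_lim_spec. intros eps.
    apply is_derive_Reals in Hu. destruct (Hu eps (cond_pos eps)) as [d Hd].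
    apply punctured_Rabs with d. apply cond_pos. intros y Hy Hne.
    specialize (Hd (y - x)). replace (x + (y - x)) with y in Hd by ring.
    rewrite H0, Rminus_0_r in Hd. apply Hd; auto. lra. }
  intros Hf Hg F0 G0 Hne.
  apply is_lim_ext_loc with (fun y => (f y / (y - x)) / (g y / (y - x))).
  - assert (HL : Rbar_locally' x (fun y => g y / (y - x) <> 0)).
    { pose proof (Q g g' Hg G0) as L. apply is_lim_spec in L.
      destruct (L (mkposreal (Rabs g') (Rabs_pos_lt _ Hne))) as [d Hd].
      apply punctured_Rabs with d. apply cond_pos.
      intros y Hy Hyx E. specialize (Hd y Hy Hyx). simpl in Hd.
      rewrite E, Rminus_0_l, Rabs_Ropp in Hd. lra. }
    destruct HL as [d Hd]. apply punctured_Rabs with d. apply cond_pos.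
    intros y Hy Hyx. specialize (Hd y Hy Hyx).
    field. split; try lra. intros E. apply Hd. rewrite E. field. lra.
  - apply (is_lim_div (fun y => f y / (y - x)) (fun y => g y / (y - x)) x f' g').
    + apply Q; auto.
    + apply Q; auto.
    + congruence.
    + simpl. auto.
Qed.

(** Beyond a finite radius the terms would not tend to 0. *)
Lemma CV_radius_infinite_of_ex_series (a : nat -> R) :
  (forall x, 0 <= x -> ex_series (fun n => a n * x ^ n)) -> CV_radius a = p_infty.
Proof.
  intros H. pose proof (CV_radius_ge_0 a) as H0.
  destruct (CV_radius a) as [r| |] eqn:E; auto.
  - simpl in H0. exfalso. apply (CV_disk_outside a (r + 1)).
    + rewrite E, Rabs_pos_eq by lra. simpl. lra.
    + apply ex_series_lim_0, H. lra.
  - destruct H0.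
Qed.

Lemma is_derive_entire (a : nat -> R) (x : R) : CV_radius a = p_infty ->
  is_derive (PSeries a) x (PSeries (PS_derive a) x).
Proof. intros H. apply is_derive_PSeries. rewrite H. exact I. Qed.

Lemma CV_radius_infinite_derive (a : nat -> R) : CV_radius a = p_infty ->
  CV_radius (PS_derive a) = p_infty.
Proof. intros H. rewrite CV_radius_derive. auto. Qed.

Lemma ex_pseries_entire (a : nat -> R) (x : R) : CV_radius a = p_infty -> ex_pseries a x.
Proof. intros H. apply CV_radius_inside. rewrite H. exact I. Qed.

(** * Euler's constant *)

Fixpoint harmonic (n : nat) : R :=
  match n with O => 0 | S m => harmonic m + / INR (S m) end.

(** Truncations of the Euler-Maclaurin expansion of Euler's constant, which
    alternate around it. *)
Definition euler_upper (n : nat) : R :=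
  harmonic n - ln (INR n) - / (2 * INR n) + / (12 * INR n ^ 2).

Definition euler_lower (n : nat) : R := euler_upper n - / (120 * INR n ^ 4).

Definition euler_gamma : R := real (Lim_seq (fun n => harmonic n - ln (INR n))).

(** At [t = 1/n] these two bounds are the statements that [euler_upper]
    decreases and [euler_lower] increases.  Each holds because the difference of
    its sides vanishes at 0 and has a derivative of constant sign:
    [t^4 / (6 (1+t)^3)] for the first, and
    [t^6 (5 + 5t + t^2) / (30 (1+t)^5)] for the second. *)
Lemma ln_1p_euler_bounds (t : R) : 0 <= t ->
  0 <= ln (1 + t) - t / 2 - t / (2 * (1 + t)) + t ^ 2 / 12
       - t ^ 2 / (12 * (1 + t) ^ 2)
    <= (t ^ 4 - t ^ 4 / (1 + t) ^ 4) / 120.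
Proof.
  intros Ht. split.
  - apply (nonneg_of_derive_nonneg (fun t => ln (1 + t) - t / 2 - t / (2 * (1 + t)) + t ^ 2 / 12
       - t ^ 2 / (12 * (1 + t) ^ 2)) (fun t => t ^ 4 / (6 * (1 + t) ^ 3))); auto.
    + rewrite Rplus_0_r, ln_1. field.
    + intros s Hs. auto_derive.
      * repeat split; try lra; apply Rgt_not_eq; nra.
      * field. lra.
    + intros s Hs. apply Rle_mult_inv_pos. apply pow_le; lra.
      assert (0 < (1 + s) ^ 3) by (apply pow_lt; lra). lra.
  - apply Rminus_le_0.
    apply (nonneg_of_derive_nonneg (fun t => (t ^ 4 - t ^ 4 / (1 + t) ^ 4) / 120 -
      (ln (1 + t) - t / 2 - t / (2 * (1 + t)) + t ^ 2 / 12
       - t ^ 2 / (12 * (1 + t) ^ 2)))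
      (fun t => t ^ 6 * (5 + 5 * t + t ^ 2) / (30 * (1 + t) ^ 5))); auto.
    + rewrite Rplus_0_r, ln_1. field.
    + intros s Hs. auto_derive.
      * assert (0 < 1 + s) by lra. repeat split; try lra; apply Rgt_not_eq;
          repeat apply Rmult_lt_0_compat; lra.
      * field. lra.
    + intros s Hs. apply Rle_mult_inv_pos.
      * apply Rmult_le_pos. apply pow_le; lra. nra.
      * assert (0 < (1 + s) ^ 5) by (apply pow_lt; lra). lra.
Qed.

Lemma euler_bounds_step (n : nat) : (1 <= n)%nat ->
  euler_upper (S n) <= euler_upper n /\ euler_lower n <= euler_lower (S n).
Proof.
  intros Hn. assert (Hn' : 1 <= INR n) by (apply (le_INR 1); auto).
  destruct (ln_1p_euler_bounds (/ INR n)) as [H1 H2].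
  { left. apply Rinv_0_lt_compat. lra. }
  unfold euler_lower, euler_upper. cbn [harmonic]. rewrite S_INR.
  replace (ln (INR n + 1)) with (ln (INR n) + ln (1 + / INR n)).
  2:{ rewrite <- ln_mult; [f_equal; field; lra| lra |].
      pose proof (Rinv_0_lt_compat (INR n)). lra. }
  revert H1 H2. generalize (ln (1 + / INR n)). generalize (ln (INR n)).
  intros L l H1 H2. set (x := INR n) in *. split.
  - apply Rminus_le_0. eapply Rle_trans. exact H1. right. field. lra.
  - apply Rminus_le_0. apply Rminus_le_0 in H2. eapply Rle_trans. exact H2.
    right. field. lra.
Qed.

Lemma euler_upper_anti (m n : nat) : (1 <= m)%nat -> (m <= n)%nat ->
  euler_upper n <= euler_upper m.
Proof.
  intros Hm H. induction H. lra.
  destruct (euler_bounds_step m0). lia. lra.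
Qed.

Lemma euler_lower_mono (m n : nat) : (1 <= m)%nat -> (m <= n)%nat ->
  euler_lower m <= euler_lower n.
Proof.
  intros Hm H. induction H. lra.
  destruct (euler_bounds_step m0). lia. lra.
Qed.

Lemma euler_lower_le_upper (n : nat) : (1 <= n)%nat -> euler_lower n <= euler_upper n.
Proof.
  intros Hn. unfold euler_lower.
  assert (0 < / (120 * INR n ^ 4)); [|lra].
  apply Rinv_0_lt_compat. apply Rmult_lt_0_compat. lra.
  apply pow_lt, lt_0_INR. lia.
Qed.

(** [euler_upper] decreases and is bounded below by [euler_lower 1]; the three
    sequences differ by terms that tend to 0. *)
Lemma euler_gamma_lim :
  is_lim_seq (fun n => harmonic n - ln (INR n)) euler_gamma /\
  is_lim_seq euler_upper euler_gamma /\ is_lim_seq euler_lower euler_gamma.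
Proof.
  pose proof is_lim_seq_inv_INR as I1.
  assert (E : ex_finite_lim_seq (fun n => euler_upper (S n))).
  { apply ex_finite_lim_seq_decr with (euler_lower 1).
    - intros n. apply euler_upper_anti; lia.
    - intros n. eapply Rle_trans. apply (euler_lower_mono 1 (S n)); lia.
      apply euler_lower_le_upper. lia. }
  destruct E as [l Hl].
  apply (is_lim_seq_incr_1 euler_upper) in Hl.
  assert (Hg : is_lim_seq (fun n => harmonic n - ln (INR n)) l).
  { apply is_lim_seq_ext_loc with
      (fun n => euler_upper n + / 2 * / INR n - / 12 * (/ INR n * / INR n)).
    - exists 1%nat. intros n Hn. unfold euler_upper.
      apply (le_INR 1) in Hn. simpl in Hn. generalize (ln (INR n)). intros. field. lra.
    - replace (Finite l) with (Finite (l + / 2 * 0 - / 12 * (0 * 0)))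
        by (f_equal; ring).
      apply is_lim_seq_minus'. apply is_lim_seq_plus'. auto.
      apply (is_lim_seq_scal_l _ (/2) 0); auto.
      apply (is_lim_seq_scal_l _ (/12) (0 * 0)). apply is_lim_seq_mult'; auto. }
  assert (El : euler_gamma = l).
  { unfold euler_gamma. rewrite (is_lim_seq_unique _ _ Hg). auto. }
  rewrite El. repeat split; auto.
  unfold euler_lower.
  apply is_lim_seq_ext_loc with (fun n => euler_upper n -
    / 120 * (/ INR n * / INR n * / INR n * / INR n)).
  - exists 1%nat. intros n Hn. apply (le_INR 1) in Hn. simpl in Hn. field. lra.
  - replace (Finite l) with (Finite (l - / 120 * (0 * 0 * 0 * 0)))
        by (f_equal; ring).
    apply is_lim_seq_minus'. auto.
    apply (is_lim_seq_scal_l _ (/120) (0 * 0 * 0 * 0)).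
    repeat apply is_lim_seq_mult'; auto.
Qed.

Lemma euler_gamma_bounds (n : nat) : (1 <= n)%nat ->
  euler_lower n <= euler_gamma <= euler_upper n.
Proof.
  intros Hn. destruct euler_gamma_lim as [_ [Hu Hl]]. split.
  - apply (is_lim_seq_le_loc (fun _ => euler_lower n) euler_lower
             (euler_lower n) euler_gamma).
    + exists n. intros. apply euler_lower_mono; auto.
    + apply is_lim_seq_const.
    + auto.
  - apply (is_lim_seq_le_loc euler_upper (fun _ => euler_upper n)
             euler_gamma (euler_upper n)).
    + exists n. intros. apply euler_upper_anti; auto.
    + auto.
    + apply is_lim_seq_const.
Qed.

(** * The reciprocal Gamma function near 1 *)

Definition gauss_product (z : R) (n : nat) : R :=
  prod_f_R0 (fun k => z + INR k) n / (INR (fact n) * Rpower (INR n) z).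

(** [rgamma] is a total limit operator, so its value only carries information
    together with convergence. *)
Definition gauss_converges (z : R) : Prop :=
  is_lim_seq (gauss_product z) (rgamma z).

Lemma rgamma_of_lim (z l : R) :
  is_lim_seq (gauss_product z) l -> rgamma z = l /\ gauss_converges z.
Proof.
  intros H.
  assert (E : rgamma z = l).
  { unfold rgamma. fold (gauss_product z). rewrite (is_lim_seq_unique _ _ H). auto. }
  split; auto. unfold gauss_converges. rewrite E. auto.
Qed.

(** The numerators of the Gauss products at [z] and [z + 1] share all factors
    but the first and the last, which makes both shifts of [rgamma] immediate. *)
Lemma gauss_product_shift (z : R) (n : nat) : (1 <= n)%nat ->
  gauss_product z n * (1 + (z + 1) * / INR n) = z * gauss_product (z + 1) n.
Proof.
  intros Hn. assert (H1 : 1 <= INR n) by (apply (le_INR 1); auto).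
  assert (E : forall m, prod_f_R0 (fun k => z + INR k) m * (z + INR (S m))
                    = z * prod_f_R0 (fun k => z + 1 + INR k) m).
  { induction m as [|m IH]. simpl; ring.
    cbn [prod_f_R0]. rewrite (S_INR (S m)). rewrite IH. rewrite S_INR. ring. }
  unfold gauss_product. rewrite Rpower_plus, Rpower_1 by lra.
  specialize (E n). rewrite S_INR in E.
  assert (0 < Rpower (INR n) z) by apply exp_pos.
  pose proof (INR_fact_neq_0 n).
  apply Rmult_eq_reg_r with (INR (fact n) * Rpower (INR n) z * INR n).
  2:{ apply Rmult_integral_contrapositive_currified; [|lra].
      apply Rmult_integral_contrapositive_currified; lra. }
  transitivity (prod_f_R0 (fun k => z + INR k) n * (z + (INR n + 1))).
  - field. repeat split; lra.
  - rewrite E. field. repeat split; lra.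
Qed.

Lemma rgamma_shift_down (z : R) : gauss_converges (z + 1) ->
  gauss_converges z /\ rgamma z = z * rgamma (z + 1).
Proof.
  intros H. apply and_comm. apply rgamma_of_lim.
  replace (z * rgamma (z + 1)) with (z * rgamma (z + 1) / (1 + (z + 1) * 0))
    by (field; lra).
  apply is_lim_seq_ext_loc with
    (fun n => z * gauss_product (z + 1) n / (1 + (z + 1) * / INR n)).
  - destruct (nfloor_ex (Rabs (z + 1))) as [N [_ HN]]. apply Rabs_pos.
    (* Beyond |z + 1| the factor 1 + (z + 1)/n does not vanish. *)
    exists (S N). intros n Hn. assert (INR N + 1 <= INR n)
      by (rewrite <- S_INR; apply le_INR; auto).
    rewrite <- gauss_product_shift by lia. field.
    pose proof (pos_INR N). pose proof (Rle_abs (-(z + 1))). rewrite Rabs_Ropp in *.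
    split; lra.
  - apply is_lim_seq_div'.
    + apply (is_lim_seq_scal_l _ z (rgamma (z + 1))). auto.
    + apply is_lim_seq_plus'. apply is_lim_seq_const.
      apply (is_lim_seq_scal_l _ (z + 1) 0). apply is_lim_seq_inv_INR.
    + lra.
Qed.

Lemma rgamma_shift_up (z : R) : z <> 0 -> gauss_converges z ->
  gauss_converges (z + 1) /\ rgamma (z + 1) = rgamma z / z.
Proof.
  intros Hz H. apply and_comm. apply rgamma_of_lim.
  apply is_lim_seq_ext_loc with
    (fun n => / z * (gauss_product z n * (1 + (z + 1) * / INR n))).
  - exists 1%nat. intros n Hn. rewrite gauss_product_shift by auto. field. auto.
  - replace (rgamma z / z) with (/ z * (rgamma z * (1 + (z + 1) * 0)))
      by (field; auto).
    apply (is_lim_seq_scal_l _ (/ z) (rgamma z * (1 + (z + 1) * 0))).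
    apply is_lim_seq_mult'. auto.
    apply is_lim_seq_plus'. apply is_lim_seq_const.
    apply (is_lim_seq_scal_l _ (z + 1) 0). apply is_lim_seq_inv_INR.
Qed.

(** Up to a term that tends to 0, the logarithm of the Gauss product at [1 + h]
    is the sum of these terms plus [h (H_n - ln n)]; subtracting the linear part
    makes the series converge absolutely. *)
Definition log_defect (h : R) (k : nat) : R :=
  ln (1 + h * / INR (S k)) - h * / INR (S k).

(** Both sides come from [ln y <= y - 1], applied to [1 + u] and to its
    inverse. *)
Lemma ln_1p_quadratic (u : R) : Rabs u <= 1 / 2 ->
  Rabs (ln (1 + u) - u) <= 2 * u ^ 2.
Proof.
  intros Hu. apply Rabs_le_between in Hu.
  assert (Hln : forall y, 0 < y -> ln y <= y - 1).
  { intros y Hy. pose proof (exp_ineq1_le (ln y)). rewrite exp_ln in H; lra. }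
  apply Rabs_le. split.
  - pose proof (Hln (/ (1 + u))) as H.
    assert (0 < / (1 + u)) by (apply Rinv_0_lt_compat; lra).
    rewrite ln_Rinv in H by lra. specialize (H H0).
    assert (/ (1 + u) = 1 - u + u ^ 2 * / (1 + u)) by (field; lra).
    assert (/ (1 + u) <= / / 2) by (apply Rinv_le_contravar; lra).
    rewrite Rinv_inv in H2. pose proof (pow2_ge_0 u). nra.
  - pose proof (Hln (1 + u)). pose proof (pow2_ge_0 u). lra.
Qed.

Lemma is_series_telescoping :
  is_series (fun k => / INR (S k) - / INR (S (S k))) 1.
Proof.
  change (is_lim_seq (sum_n (fun k => / INR (S k) - / INR (S (S k)))) 1).
  apply is_lim_seq_ext with (fun n => 1 - / INR (S (S n))).
  - intros n. induction n as [|n IH].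
    + rewrite sum_O. simpl. field.
    + rewrite sum_Sn. rewrite <- IH. unfold plus; simpl. ring.
  - replace (Finite 1) with (Finite (1 - 0)) by (f_equal; ring).
    apply is_lim_seq_minus'. apply is_lim_seq_const.
    apply (proj1 (is_lim_seq_incr_1 (fun n => / INR (S n)) 0)).
    apply (proj1 (is_lim_seq_incr_1 (fun n => / INR n) 0)).
    apply is_lim_seq_inv_INR.
Qed.

(** The bound [2 h^2 / (k+1)^2] is replaced by a telescoping one, whose sum is
    known exactly. *)
Lemma log_defect_bound (h : R) (k : nat) : Rabs h <= 1 / 2 ->
  Rabs (log_defect h k) <= 4 * h ^ 2 * (/ INR (S k) - / INR (S (S k))).
Proof.
  intros Hh. unfold log_defect. pose proof (pos_INR k).
  rewrite (S_INR (S k)), S_INR. set (x := INR k + 1).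
  assert (Hx : 1 <= x) by (unfold x; lra).
  assert (Hi : 0 < / x <= 1).
  { split. apply Rinv_0_lt_compat; lra. rewrite <- Rinv_1. apply Rinv_le_contravar; lra. }
  eapply Rle_trans. apply ln_1p_quadratic.
  - rewrite Rabs_mult. rewrite (Rabs_pos_eq (/ x)) by lra.
    pose proof (Rabs_pos h). nra.
  - replace (2 * (h * / x) ^ 2) with (2 * h ^ 2 * / x ^ 2) by (field; lra).
    replace (4 * h ^ 2 * (/ x - / (x + 1))) with (2 * h ^ 2 * (2 / (x * (x + 1))))
      by (field; lra).
    apply Rmult_le_compat_l. pose proof (pow2_ge_0 h). lra.
    apply Rmult_le_reg_r with (x ^ 2 * (x + 1)). nra.
    replace (/ x ^ 2 * (x ^ 2 * (x + 1))) with (x + 1) by (field; lra).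
    replace (2 / (x * (x + 1)) * (x ^ 2 * (x + 1))) with (2 * x) by (field; lra). lra.
Qed.

Definition log_defect_sum (h : R) : R := Series (log_defect h).

Lemma log_defect_summable (h : R) : Rabs h <= 1 / 2 ->
  is_series (log_defect h) (log_defect_sum h) /\
  Rabs (log_defect_sum h) <= 4 * h ^ 2.
Proof.
  intros Hh.
  assert (HS : is_series (fun k => 4 * h ^ 2 * (/ INR (S k) - / INR (S (S k)))) (4 * h ^ 2)).
  { rewrite <- (Rmult_1_r (4 * h ^ 2)) at 1.
    exact (is_series_scal (4 * h ^ 2) _ _ is_series_telescoping). }
  assert (Ea : ex_series (fun k => Rabs (log_defect h k))).
  { apply (ex_series_le (fun k => Rabs (log_defect h k))
       (fun k => 4 * h ^ 2 * (/ INR (S k) - / INR (S (S k))))).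
    - intros k. unfold norm; simpl. unfold abs; simpl. rewrite Rabs_Rabsolu.
      apply log_defect_bound; auto.
    - eexists; exact HS. }
  split.
  - apply Series_correct. apply ex_series_Rabs. auto.
  - eapply Rle_trans. apply Series_Rabs. auto.
    rewrite <- (is_series_unique _ _ HS). apply Series_le.
    + intros k. split. apply Rabs_pos. apply log_defect_bound; auto.
    + eexists; exact HS.
Qed.

(** Each factor [1 + h/k] is [exp (log_defect + h/k)]; the leading factor is
    the last term of the product, the only one without a partner in [n!]. *)
Lemma gauss_product_near_1 (h : R) (m : nat) : Rabs h <= 1 / 2 ->
  gauss_product (1 + h) (S m) =
  (1 + (1 + h) * / INR (S m)) *
  exp (sum_n (log_defect h) m + h * (harmonic (S m) - ln (INR (S m)))).
Proof.
  intros Hh. apply Rabs_le_between in Hh.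
  assert (Hx : forall k, 1 <= INR (S k)) by (intros k; apply (le_INR 1); lia).
  assert (P : prod_f_R0 (fun k => 1 + h + INR k) (S m) =
     INR (fact (S m)) * (INR (S m) + 1 + h) *
     exp (sum_n (log_defect h) m + h * harmonic (S m))).
  { assert (F : forall k, exp (log_defect h k + h * / INR (S k)) = 1 + h * / INR (S k)).
    { intros k. unfold log_defect. rewrite <- (exp_ln (1 + h * / INR (S k))) at 2.
      f_equal; ring.
      specialize (Hx k). apply Rmult_lt_reg_r with (INR (S k)). lra.
      rewrite Rmult_plus_distr_r, Rmult_assoc, Rinv_l by lra. lra. }
    induction m as [|m IH].
    - rewrite sum_O. cbn [harmonic].
      replace (log_defect h 0 + h * (0 + / INR 1)) with
         (log_defect h 0 + h * / INR 1) by ring.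
      rewrite F. simpl. field.
    - change (prod_f_R0 (fun k => 1 + h + INR k) (S (S m))) with
        (prod_f_R0 (fun k => 1 + h + INR k) (S m) * (1 + h + INR (S (S m)))).
      rewrite IH, sum_Sn. change (@plus R_AbelianMonoid) with Rplus.
      change (harmonic (S (S m))) with (harmonic (S m) + / INR (S (S m))).
      replace (sum_n (log_defect h) m + log_defect h (S m) +
        h * (harmonic (S m) + / INR (S (S m)))) with
       ((sum_n (log_defect h) m + h * harmonic (S m)) +
        (log_defect h (S m) + h * / INR (S (S m)))) by ring.
      rewrite (exp_plus _ (log_defect h (S m) + _)), F.
      change (fact (S (S m))) with (S (S m) * fact (S m))%nat.
      rewrite mult_INR. specialize (Hx (S m)). rewrite (S_INR (S m)) in *. field. lra. }
  unfold gauss_product. rewrite P. unfold Rpower.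
  replace (sum_n (log_defect h) m + h * (harmonic (S m) - ln (INR (S m)))) with
    ((sum_n (log_defect h) m + h * harmonic (S m)) + - (h * ln (INR (S m)))) by ring.
  rewrite (exp_plus _ (- _)), exp_Ropp.
  replace ((1 + h) * ln (INR (S m))) with (ln (INR (S m)) + h * ln (INR (S m))) by ring.
  specialize (Hx m).
  rewrite (exp_plus (ln _)), exp_ln by lra.
  field. repeat split; try apply Rgt_not_eq, exp_pos; try lra. apply INR_fact_neq_0.
Qed.

Lemma rgamma_near_1 (h : R) : Rabs h <= 1 / 2 ->
  rgamma (1 + h) = exp (log_defect_sum h + h * euler_gamma) /\
  gauss_converges (1 + h).
Proof.
  intros Hh. apply rgamma_of_lim. apply is_lim_seq_incr_1.
  eapply is_lim_seq_ext. intros n. symmetry. apply gauss_product_near_1; auto.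
  replace (exp (log_defect_sum h + h * euler_gamma)) with
    ((1 + (1 + h) * 0) * exp (log_defect_sum h + h * euler_gamma)) by ring.
  apply is_lim_seq_mult'.
  - apply is_lim_seq_plus'. apply is_lim_seq_const.
    apply (is_lim_seq_scal_l _ (1 + h) 0).
    apply (proj1 (is_lim_seq_incr_1 (fun n => / INR n) 0)). apply is_lim_seq_inv_INR.
  - apply (is_lim_seq_continuous exp).
    + apply derivable_continuous_pt, derivable_pt_exp.
    + apply is_lim_seq_plus'.
      * destruct (log_defect_summable h Hh) as [H _]. exact H.
      * apply (is_lim_seq_scal_l _ h euler_gamma).
        apply (proj1 (is_lim_seq_incr_1 (fun n => harmonic n - ln (INR n)) euler_gamma)).
        apply euler_gamma_lim.
Qed.

Lemma log_defect_sum_0 : log_defect_sum 0 = 0.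
Proof.
  destruct (log_defect_summable 0) as [_ H]. rewrite Rabs_R0; lra.
  replace (4 * 0 ^ 2) with 0 in H by ring.
  pose proof (Rabs_pos (log_defect_sum 0)).
  destruct (Req_dec (log_defect_sum 0) 0); auto. apply Rabs_pos_lt in H1. lra.
Qed.

Lemma rgamma_1 : rgamma 1 = 1.
Proof.
  replace 1 with (1 + 0) at 1 by ring.
  destruct (rgamma_near_1 0) as [H _]. rewrite Rabs_R0; lra.
  rewrite H, log_defect_sum_0, Rmult_0_l, Rplus_0_l, exp_0. auto.
Qed.

(** [rgamma (1 + h) = exp (h * euler_gamma + O(h^2))]. *)
Lemma is_derive_rgamma_1 : is_derive (fun h => rgamma (1 + h)) 0 euler_gamma.
Proof.
  assert (D : is_derive log_defect_sum 0 0).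
  { apply derive_of_quadratic_bound with 4 (1 / 2). lra.
    intros h Hh. rewrite log_defect_sum_0, Rplus_0_l, Rmult_0_r, !Rminus_0_r.
    apply log_defect_summable. auto. }
  apply is_derive_ext_loc with (fun h => exp (log_defect_sum h + h * euler_gamma)).
  - exists (mkposreal (1 / 2) ltac:(lra)). intros h Hh.
    symmetry. apply rgamma_near_1. unfold ball in Hh; simpl in Hh.
    unfold AbsRing_ball, abs, minus, plus, opp in Hh; simpl in Hh.
    rewrite Ropp_0, Rplus_0_r in Hh. lra.
  - auto_derive. eexists; exact D.
    replace (Derive (fun h : R => log_defect_sum h) 0) with 0
      by (symmetry; apply is_derive_unique, D).
    rewrite log_defect_sum_0, Rmult_0_l, Rplus_0_l, exp_0.
    ring.
Qed.

(** * The hypergeometric factor as a function of the order *)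

(** The inverse Pochhammer symbol [1 / ((nu+1) ... (nu+k))]. *)
Fixpoint inv_rising (nu : R) (k : nat) : R :=
  match k with O => 1 | S j => inv_rising nu j / (nu + INR (S j)) end.

(** The derivative of [inv_rising] in [nu], by the quotient rule. *)
Fixpoint inv_rising_deriv (nu : R) (k : nat) : R :=
  match k with
  | O => 0
  | S j => inv_rising_deriv nu j / (nu + INR (S j))
           - inv_rising nu j / (nu + INR (S j)) ^ 2
  end.

Lemma inv_rising_bound (nu : R) (k : nat) : - (1 / 2) <= nu ->
  0 <= inv_rising nu k <= 2 ^ k.
Proof.
  intros Hn. induction k as [|k IH]; cbn [inv_rising pow]. lra.
  pose proof (INR_S_ge_1 k).
  assert (0 < / (nu + INR (S k))) by (apply Rinv_0_lt_compat; lra).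
  assert (/ (nu + INR (S k)) <= / / 2) by (apply Rinv_le_contravar; lra).
  rewrite Rinv_inv in H1. unfold Rdiv. split; nra.
Qed.

Lemma inv_rising_bound_nonneg (nu : R) (k : nat) : 0 <= nu ->
  0 <= inv_rising nu k <= 1 /\ Rabs (inv_rising_deriv nu k) <= INR k.
Proof.
  intros Hn. induction k as [|k [IH1 IH2]]; cbn [inv_rising inv_rising_deriv].
  - rewrite Rabs_R0. simpl. lra.
  - pose proof (INR_S_ge_1 k).
    assert (0 < / (nu + INR (S k))) by (apply Rinv_0_lt_compat; lra).
    assert (/ (nu + INR (S k)) <= / 1) by (apply Rinv_le_contravar; lra).
    rewrite Rinv_1 in H1. unfold Rdiv. rewrite <- pow_inv. set (s := / (nu + INR (S k))) in *.
    split. split; nra.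
    rewrite S_INR. eapply Rle_trans. apply Rabs_triang.
    rewrite Rabs_Ropp, !Rabs_mult, (Rabs_pos_eq s), (Rabs_pos_eq (inv_rising nu k)),
      (Rabs_pos_eq (s ^ 2)) by nra.
    pose proof (Rabs_pos (inv_rising_deriv nu k)).
    assert (0 <= s ^ 2 <= 1) by (simpl; nra).
    apply Rplus_le_compat; nra.
Qed.

(** A Taylor remainder that is uniform enough to be summed against [z^k / k!].
    The induction costs a factor at most 2 for the new denominator, plus a term
    linear in [k]; [4 ^ k] absorbs both. *)
Lemma inv_rising_quadratic (nu h : R) (k : nat) : 0 <= nu -> Rabs h <= 1 / 2 ->
  Rabs (inv_rising (nu + h) k - inv_rising nu k - h * inv_rising_deriv nu k)
    <= 4 ^ k * h ^ 2.
Proof.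
  intros Hn Hh. induction k as [|k IH].
  - simpl. replace (1 - 1 - h * 0) with 0 by ring. rewrite Rabs_R0. nra.
  - destruct (inv_rising_bound_nonneg nu k Hn) as [B1 B2].
    pose proof (INR_S_ge_1 k) as H1. pose proof (proj1 (Rabs_le_between _ _) Hh) as Hh'.
    cbn [inv_rising inv_rising_deriv].
    set (r := inv_rising nu k) in *. set (r' := inv_rising (nu + h) k) in *.
    set (d := inv_rising_deriv nu k) in *.
    set (e := r' - r - h * d) in *.
    set (s0 := / (nu + INR (S k))). set (s := / (nu + h + INR (S k))).
    assert (S0 : 0 < s0 <= 1).
    { split. apply Rinv_0_lt_compat; lra.
      rewrite <- Rinv_1. apply Rinv_le_contravar; lra. }
    assert (S1 : 0 < s <= 2).
    { split. apply Rinv_0_lt_compat; lra.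
      rewrite <- (Rinv_inv 2). apply Rinv_le_contravar; lra. }
    (* Split into the inherited remainder times s and the first two remainders
       s - s0 + h s0^2 = h^2 s0^2 s and s - s0 = - h s0 s of the new factor. *)
    replace (r' / (nu + h + INR (S k)) - r / (nu + INR (S k)) -
       h * (d / (nu + INR (S k)) - r / (nu + INR (S k)) ^ 2))
    with (e * s + (h ^ 2 * (s0 ^ 2 * s * r) - h ^ 2 * (s0 * s * d)))
      by (unfold e, s, s0; field; lra).
    eapply Rle_trans. apply Rabs_triang.
    eapply Rle_trans. apply Rplus_le_compat_l. apply Rabs_triang.
    rewrite Rabs_Ropp, !Rabs_mult.
    rewrite (Rabs_pos_eq (h ^ 2)) by apply pow2_ge_0.
    rewrite (Rabs_pos_eq (s0 ^ 2)) by apply pow2_ge_0.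
    rewrite (Rabs_pos_eq s), (Rabs_pos_eq s0), (Rabs_pos_eq r) by lra.
    (* 2 * 4^k + 2 + 2k <= 4^(k+1) reduces to this. *)
    assert (Hk : 1 + INR k <= 4 ^ k).
    { clear. induction k as [|k IH]. simpl; lra. rewrite S_INR. simpl.
      pose proof (pos_INR k). lra. }
    pose proof (pow2_ge_0 h) as Hh2.
    assert (s0 * s <= 2) by nra. assert (0 < s0 * s) by nra.
    assert (E1 : Rabs e * s <= 4 ^ k * h ^ 2 * 2).
    { pose proof (Rabs_pos e). apply Rmult_le_compat; lra. }
    assert (E2 : h ^ 2 * (s0 ^ 2 * s * r) <= h ^ 2 * 2).
    { apply Rmult_le_compat_l; auto.
      replace (s0 ^ 2 * s * r) with (s0 * s * (s0 * r)) by ring.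
      assert (0 <= s0 * r <= 1) by nra. nra. }
    assert (E3 : h ^ 2 * (s0 * s * Rabs d) <= h ^ 2 * (2 * INR k)).
    { apply Rmult_le_compat_l; auto. pose proof (Rabs_pos d).
      apply Rmult_le_compat; lra. }
    change (4 ^ S k) with (4 * 4 ^ k).
    assert (h ^ 2 * (1 + INR k) <= h ^ 2 * 4 ^ k) by (apply Rmult_le_compat_l; auto).
    lra.
Qed.

Lemma exp_dominated_series (z M : R) (b : nat -> R) : 0 <= z ->
  (forall k, Rabs (b k) <= 4 ^ k * M) ->
  ex_series (fun k => z ^ k / INR (fact k) * b k) /\
  Rabs (Series (fun k => z ^ k / INR (fact k) * b k)) <= exp (4 * z) * M.
Proof.
  intros Hz Hb.
  assert (HE : is_series (fun k => / INR (fact k) * (4 * z) ^ k * M) (exp (4 * z) * M)).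
  { apply (is_series_scal_r M). apply is_pseries_R. apply is_exp_Reals. }
  assert (Hle : forall k, Rabs (z ^ k / INR (fact k) * b k)
                     <= / INR (fact k) * (4 * z) ^ k * M).
  { intros k. pose proof (INR_fact_lt_0 k).
    assert (0 <= z ^ k / INR (fact k)).
    { apply Rle_mult_inv_pos; auto. apply pow_le; auto. }
    rewrite Rabs_mult, (Rabs_pos_eq (_ / _)) by auto.
    replace (/ INR (fact k) * (4 * z) ^ k * M) with
      (z ^ k / INR (fact k) * (4 ^ k * M)) by (rewrite Rpow_mult_distr; field; lra).
    apply Rmult_le_compat_l; auto. }
  assert (Ea : ex_series (fun k => Rabs (z ^ k / INR (fact k) * b k))).
  { apply (ex_series_le (fun k => Rabs (z ^ k / INR (fact k) * b k))
      (fun k => / INR (fact k) * (4 * z) ^ k * M)).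
    - intros k. unfold norm; simpl. unfold abs; simpl. rewrite Rabs_Rabsolu. auto.
    - eexists; exact HE. }
  split. apply ex_series_Rabs; auto.
  eapply Rle_trans. apply Series_Rabs; auto.
  rewrite <- (is_series_unique _ _ HE). apply Series_le.
  - intros k. split. apply Rabs_pos. auto.
  - eexists; exact HE.
Qed.

(** The confluent hypergeometric function 0F1(; nu+1; z). *)
Definition hyper01 (z nu : R) : R :=
  Series (fun k => z ^ k / INR (fact k) * inv_rising nu k).

Definition hyper01_deriv (z nu : R) : R :=
  Series (fun k => z ^ k / INR (fact k) * inv_rising_deriv nu k).

Lemma hyper01_summable (z nu : R) : 0 <= z -> - (1 / 2) <= nu ->
  ex_series (fun k => z ^ k / INR (fact k) * inv_rising nu k).
Proof.
  intros Hz Hn. apply (exp_dominated_series z 1); auto.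
  intros k. destruct (inv_rising_bound nu k Hn). rewrite Rabs_pos_eq by auto.
  eapply Rle_trans; [eassumption|]. rewrite Rmult_1_r. apply pow_incr. lra.
Qed.

(** Summing the quadratic remainders gives a remainder at most
    [exp (4 z) * h ^ 2]. *)
Lemma is_derive_hyper01 (z nu : R) : 0 <= z -> 0 <= nu ->
  is_derive (hyper01 z) nu (hyper01_deriv z nu).
Proof.
  intros Hz Hn. apply derive_of_quadratic_bound with (exp (4 * z)) (1 / 2). lra.
  intros h Hh. pose proof (proj1 (Rabs_le_between _ _) Hh).
  unfold hyper01, hyper01_deriv.
  rewrite <- Series_minus by (apply hyper01_summable; auto; lra).
  assert (Ed : ex_series (fun k => z ^ k / INR (fact k) * inv_rising_deriv nu k)).
  { apply (exp_dominated_series z 1); auto. intros k.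
    destruct (inv_rising_bound_nonneg nu k Hn) as [_ B]. eapply Rle_trans; [exact B|].
    rewrite Rmult_1_r. clear. induction k as [|k IH]. simpl; lra.
    rewrite S_INR. simpl. assert (1 <= 4 ^ k) by (apply pow_R1_Rle; lra). lra. }
  rewrite <- Series_scal_l.
  rewrite <- Series_minus.
  - rewrite (Series_ext _ (fun k => z ^ k / INR (fact k) *
      (inv_rising (nu + h) k - inv_rising nu k - h * inv_rising_deriv nu k)))
      by (intros; ring).
    apply exp_dominated_series; auto. intros k. apply inv_rising_quadratic; auto.
  - apply (ex_series_minus (fun k => z ^ k / INR (fact k) * inv_rising (nu + h) k)
      (fun k => z ^ k / INR (fact k) * inv_rising nu k)); apply hyper01_summable; auto; lra.
  - apply (ex_series_scal_l h (fun k => z ^ k / INR (fact k) * inv_rising_deriv nu k)); auto.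
Qed.

Lemma inv_rising_shift (nu : R) (k : nat) : -1 < nu ->
  inv_rising nu (S k) = inv_rising (nu + 1) k / (nu + 1).
Proof.
  intros Hn. induction k as [|k IH].
  - simpl. auto.
  - change (inv_rising nu (S (S k))) with (inv_rising nu (S k) / (nu + INR (S (S k)))).
    rewrite IH. cbn [inv_rising]. rewrite (S_INR (S k)).
    pose proof (INR_S_ge_1 k). field. lra.
Qed.

(** The weight [k] cancels against [k!] and shifts the index, which raises the
    order by one; this is the mechanism of the Bessel recurrence in the order. *)
Lemma hyper01_weighted (z nu : R) : 0 <= z -> - (1 / 2) <= nu ->
  is_series (fun k => z ^ k / INR (fact k) * (INR k * inv_rising nu k))
    (z / (nu + 1) * hyper01 z (nu + 1)).
Proof.
  intros Hz Hn.
  assert (H : is_series (fun k => z / (nu + 1) *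
     (z ^ k / INR (fact k) * inv_rising (nu + 1) k)) (z / (nu + 1) * hyper01 z (nu + 1))).
  { apply (is_series_scal_l (z / (nu + 1))
       (fun k => z ^ k / INR (fact k) * inv_rising (nu + 1) k)).
    apply Series_correct, hyper01_summable; auto; lra. }
  apply is_series_decr_1.
  eapply is_series_ext with (a := fun k => z / (nu + 1) *
     (z ^ k / INR (fact k) * inv_rising (nu + 1) k)).
  - intros k. rewrite inv_rising_shift by lra.
    change (fact (S k)) with (S k * fact k)%nat. rewrite mult_INR.
    pose proof (INR_S_ge_1 k). pose proof (INR_fact_neq_0 k).
    match goal with |- ?a = ?b => change (a = b :> R) end. simpl pow. field. lra.
  - match goal with |- is_series _ ?l =>
      replace l with (z / (nu + 1) * hyper01 z (nu + 1)); auto end.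
    unfold plus, opp; simpl. ring.
Qed.

(** * Bessel functions as functions of the order *)

Lemma rgamma_plus_INR (nu : R) (k : nat) : -1 < nu -> gauss_converges (nu + 1) ->
  gauss_converges (nu + 1 + INR k) /\
  rgamma (nu + 1 + INR k) = rgamma (nu + 1) * inv_rising nu k.
Proof.
  intros Hn Hc. induction k as [|k [IH1 IH2]].
  - simpl. rewrite Rplus_0_r, Rmult_1_r. auto.
  - pose proof (pos_INR k). rewrite S_INR, <- Rplus_assoc.
    destruct (rgamma_shift_up (nu + 1 + INR k)) as [H1 H2]; auto. lra.
    split; auto. rewrite H2, IH2. cbn [inv_rising]. rewrite S_INR. field. lra.
Qed.

Lemma Rpower_double_INR (X : R) (k : nat) : 0 < X -> Rpower X (2 * INR k) = (X ^ 2) ^ k.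
Proof.
  intros HX. rewrite <- pow_mult, <- Rpower_pow by auto. f_equal.
  rewrite mult_INR. simpl. ring.
Qed.

(** [rgamma (nu+1+k)] is [rgamma (nu+1)] times an inverse Pochhammer symbol, so
    all the dependence on the Gauss limit comes out of the series. *)
Lemma besselI_factor (nu x : R) : 0 < x -> -1 < nu -> gauss_converges (nu + 1) ->
  besselI nu x = Rpower (x / 2) nu * rgamma (nu + 1) * hyper01 ((x / 2) ^ 2) nu.
Proof.
  intros Hx Hn Hc. unfold besselI, hyper01. rewrite <- Series_scal_l.
  apply Series_ext. intros k.
  replace (INR k + nu + 1) with (nu + 1 + INR k) by ring.
  destruct (rgamma_plus_INR nu k Hn Hc) as [_ E]. rewrite E.
  rewrite Rpower_plus, Rpower_double_INR by lra. field. apply INR_fact_neq_0.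
Qed.

Lemma gauss_converges_0 (e : R) : Rabs e <= 1 / 2 -> gauss_converges (e + 1).
Proof. intros H. rewrite Rplus_comm. apply rgamma_near_1; auto. Qed.

Lemma gauss_converges_1 (e : R) : Rabs e <= 1 / 2 -> gauss_converges (e + 1 + 1).
Proof.
  intros H. apply rgamma_shift_up. apply Rabs_le_between in H. lra.
  apply gauss_converges_0; auto.
Qed.

(** For [e] near 0 this moves the order [e - 1], where [rgamma] is evaluated
    next to its zero at 0, to orders where the factorization applies.  It comes
    from [rgamma (k + e) = (k + e) rgamma (k + e + 1)]. *)
Lemma besselI_recurrence (e x : R) : 0 < x -> Rabs e <= 1 / 2 ->
  besselI (e - 1) x = besselI (e + 1) x + 2 * e / x * besselI e x.
Proof.
  intros Hx He. pose proof (gauss_converges_0 e He) as C0.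
  pose proof (gauss_converges_1 e He) as C1.
  apply Rabs_le_between in He.
  rewrite (besselI_factor (e + 1)), (besselI_factor e) by (auto; lra).
  set (X := x / 2). assert (HX : 0 < X) by (unfold X; lra).
  assert (Hz : 0 <= X ^ 2) by (apply pow2_ge_0).
  destruct (rgamma_shift_up (e + 1)) as [_ E1]; auto. lra. rewrite E1.
  rewrite Rpower_plus, Rpower_1 by auto.
  unfold besselI. fold X.
  transitivity (Series (fun k => Rpower X e / X * rgamma (e + 1) *
     (e * ((X ^ 2) ^ k / INR (fact k) * inv_rising e k) +
      (X ^ 2) ^ k / INR (fact k) * (INR k * inv_rising e k)))).
  - apply Series_ext. intros k. destruct (rgamma_plus_INR e k) as [Ck Ek]; auto. lra.
    replace (INR k + (e - 1) + 1) with (e + INR k) by ring.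
    destruct (rgamma_shift_down (e + INR k)) as [_ E2].
    { replace (e + INR k + 1) with (e + 1 + INR k) by ring. auto. }
    rewrite E2. replace (e + INR k + 1) with (e + 1 + INR k) by ring. rewrite Ek.
    unfold Rminus. rewrite !Rpower_plus, Rpower_Ropp, Rpower_1, Rpower_double_INR by auto.
    field. pose proof (INR_fact_neq_0 k). repeat split; auto; lra.
  - pose proof (hyper01_weighted (X ^ 2) e Hz) as HW.
    specialize (HW ltac:(lra)).
    rewrite Series_scal_l, Series_plus, Series_scal_l.
    + rewrite (is_series_unique _ _ HW). fold (hyper01 (X ^ 2) e).
      replace x with (2 * X) by (unfold X; field). field. lra.
    + apply (ex_series_scal_l e (fun k => (X ^ 2) ^ k / INR (fact k) * inv_rising e k)).
      apply hyper01_summable; auto; lra.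
    + eexists; exact HW.
Qed.

Lemma is_derive_besselI_order (nu x g : R) : 0 < x -> 0 <= nu ->
  locally nu (fun mu => gauss_converges (mu + 1)) ->
  is_derive (fun mu => rgamma (mu + 1)) nu g ->
  is_derive (fun mu => besselI mu x) nu
    (Rpower (x / 2) nu *
      (rgamma (nu + 1) * (ln (x / 2) * hyper01 ((x / 2) ^ 2) nu
                        + hyper01_deriv ((x / 2) ^ 2) nu)
       + g * hyper01 ((x / 2) ^ 2) nu)).
Proof.
  intros Hx Hn HC Dg. set (z := (x / 2) ^ 2).
  pose proof (is_derive_hyper01 z nu (pow2_ge_0 _) Hn) as DP.
  apply is_derive_ext_loc with
    (fun mu => Rpower (x / 2) mu * rgamma (mu + 1) * hyper01 z mu).
  - apply filter_imp with (2 := filter_and _ _ HC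
      (locally_Rabs nu 1 (fun mu => Rabs (mu - nu) < 1) Rlt_0_1 (fun y H => H))).
    intros mu [H1 H2]. symmetry. apply besselI_factor; auto.
    apply Rabs_lt_between in H2. lra.
  - unfold Rpower.
    assert (DX : is_derive (fun mu => exp (mu * ln (x / 2))) nu
               (ln (x / 2) * exp (nu * ln (x / 2)))) by (auto_derive; auto; ring).
    replace (exp (nu * ln (x / 2)) * _) with
      ((ln (x / 2) * exp (nu * ln (x / 2)) * rgamma (nu + 1) +
         exp (nu * ln (x / 2)) * g) * hyper01 z nu +
       exp (nu * ln (x / 2)) * rgamma (nu + 1) * hyper01_deriv z nu) by ring.
    apply (is_derive_mult (fun mu => exp (mu * ln (x / 2)) * rgamma (mu + 1))
       (hyper01 z)); auto.
    2: intros; apply Rmult_comm.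
    apply (is_derive_mult (fun mu => exp (mu * ln (x / 2)))
       (fun mu => rgamma (mu + 1))); auto.
    intros; apply Rmult_comm.
Qed.

Lemma is_derive_rgamma_plus_1_at_0 : is_derive (fun mu => rgamma (mu + 1)) 0 euler_gamma.
Proof.
  apply is_derive_ext with (fun h => rgamma (1 + h)).
  intros t. f_equal. ring. apply is_derive_rgamma_1.
Qed.

Lemma is_derive_rgamma_plus_1_at_1 :
  is_derive (fun mu => rgamma (mu + 1)) 1 (euler_gamma - 1).
Proof.
  apply is_derive_ext_loc with (fun mu => rgamma (mu - 1 + 1) / mu).
  - apply locally_Rabs with (1 / 2). lra. intros mu Hm.
    destruct (rgamma_shift_up (mu - 1 + 1)) as [_ E].
    + apply Rabs_lt_between in Hm. lra.
    + apply gauss_converges_0. lra.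
    + replace (mu - 1 + 1) with mu in * by ring. auto.
  - replace (euler_gamma - 1) with ((euler_gamma * 1 - rgamma (1 - 1 + 1) * 1) / 1 ^ 2).
    2:{ replace (1 - 1 + 1) with 1 by ring. rewrite rgamma_1. field. }
    apply (is_derive_div (fun mu => rgamma (mu - 1 + 1)) (fun mu => mu)); try lra.
    2: apply (is_derive_id 1).
    replace euler_gamma with (scal 1 euler_gamma)
      by (unfold scal; simpl; unfold mult; simpl; ring).
    apply (is_derive_comp (fun mu => rgamma (mu + 1)) (fun mu => mu - 1)).
    + replace (1 - 1) with 0 by ring. apply is_derive_rgamma_plus_1_at_0.
    + auto_derive; auto.
Qed.

(** At an integer order the defining quotient has the form 0/0 with a simple
    zero below, and the derivative of [sin (mu * PI)] there is [PI * c]. *)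
Lemma besselK_of_derive (nu x l c : R) :
  is_derive (fun mu => besselI (- mu) x - besselI mu x) nu l ->
  besselI (- nu) x - besselI nu x = 0 -> sin (nu * PI) = 0 -> cos (nu * PI) = c -> c <> 0 ->
  besselK nu x = l / (2 * c).
Proof.
  intros D E Hs Hc Hne. unfold besselK. pose proof PI_RGT_0.
  erewrite is_lim_unique.
  2:{ apply (is_lim_scal_l (fun mu => (besselI (- mu) x - besselI mu x) / sin (mu * PI))).
      apply is_lim_quotient_of_derive with (f' := l) (g' := PI * c).
      - exact D.
      - auto_derive. auto. rewrite Hc. ring.
      - exact E.
      - exact Hs.
      - apply Rmult_integral_contrapositive_currified; lra. }
  simpl. field. lra.
Qed.

(** * Closed forms of the Bessel functions of orders 0 and 1 *)

Lemma CV_radius_infinite_of_fact_bound (a : nat -> R) :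
  (forall n, Rabs (a n * INR (fact n)) <= 1) -> CV_radius a = p_infty.
Proof.
  intros H. apply CV_radius_infinite_of_ex_series. intros x Hx.
  apply ex_series_ext with (fun n => x ^ n / INR (fact n) * (a n * INR (fact n))).
  2: apply (exp_dominated_series x 1 (fun n => a n * INR (fact n))); auto.
  - intros n. change_eq_R.
    field. apply INR_fact_neq_0.
  - intros k. eapply Rle_trans. apply H. rewrite Rmult_1_r. apply pow_R1_Rle. lra.
Qed.

(** The operator [z D^2 + D] multiplies [z^n] by [n^2 / z], so it acts on
    coefficients by a weighted shift. *)
Lemma PSeries_euler_operator (a : nat -> R) (z : R) : CV_radius a = p_infty ->
  z * PSeries (PS_derive (PS_derive a)) z + PSeries (PS_derive a) z =
  PSeries (fun n => INR (S n) ^ 2 * a (S n)) z.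
Proof.
  intros H. pose proof (CV_radius_infinite_derive _ H) as H1.
  pose proof (CV_radius_infinite_derive _ H1) as H2.
  rewrite <- PSeries_incr_1, <- PSeries_plus.
  - apply PSeries_ext. intros [|n]; unfold PS_plus, PS_incr_1, PS_derive, plus, zero; simpl.
    + ring.
    + ring.
  - apply ex_pseries_incr_1, ex_pseries_entire; auto.
  - apply ex_pseries_entire; auto.
Qed.

Definition I_coef (k : nat) : R := / INR (fact k) ^ 2.
Definition K_coef (k : nat) : R := harmonic k / INR (fact k) ^ 2.

Lemma harmonic_bounds (k : nat) : 0 <= harmonic k <= INR k.
Proof.
  induction k as [|k IH]. simpl; lra. cbn [harmonic]. rewrite S_INR.
  pose proof (pos_INR k).
  assert (0 < / (INR k + 1)) by (apply Rinv_0_lt_compat; lra).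
  assert (/ (INR k + 1) <= / 1) by (apply Rinv_le_contravar; lra). lra.
Qed.

Lemma fact_ge (k : nat) : (1 <= fact k /\ k <= fact k)%nat.
Proof. induction k as [|k [IH1 IH2]]. simpl; lia. simpl. split; nia. Qed.

Lemma INR_fact_ge (k : nat) : 1 <= INR (fact k) /\ INR k <= INR (fact k).
Proof. destruct (fact_ge k). split. apply (le_INR 1); auto. apply le_INR; auto. Qed.

Lemma I_coef_scaled (k : nat) : 0 <= I_coef k * INR (fact k) <= 1.
Proof.
  destruct (INR_fact_ge k). unfold I_coef.
  replace (/ INR (fact k) ^ 2 * INR (fact k)) with (/ INR (fact k)) by (field; lra).
  split. left; apply Rinv_0_lt_compat; lra.
  rewrite <- Rinv_1. apply Rinv_le_contravar; lra.
Qed.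

Lemma K_coef_scaled (k : nat) : 0 <= K_coef k * INR (fact k) <= 1.
Proof.
  destruct (INR_fact_ge k). destruct (harmonic_bounds k). unfold K_coef.
  replace (harmonic k / INR (fact k) ^ 2 * INR (fact k)) with
    (harmonic k / INR (fact k)) by (field; lra).
  split. apply Rle_mult_inv_pos; lra.
  apply Rle_div_l; lra.
Qed.

Lemma I_coef_entire : CV_radius I_coef = p_infty.
Proof.
  apply CV_radius_infinite_of_fact_bound. intros k.
  destruct (I_coef_scaled k). rewrite Rabs_pos_eq; auto.
Qed.

Lemma K_coef_entire : CV_radius K_coef = p_infty.
Proof.
  apply CV_radius_infinite_of_fact_bound. intros k.
  destruct (K_coef_scaled k). rewrite Rabs_pos_eq; auto.
Qed.

(** With [z = (x/2)^2], [ISer] is [I_0(x)] and [KSer] is the part of [K_0(x)]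
    without logarithm. *)
Notation ISer := (PSeries I_coef).
Notation ISer' := (PSeries (PS_derive I_coef)).
Notation ISer'' := (PSeries (PS_derive (PS_derive I_coef))).
Notation KSer := (PSeries K_coef).
Notation KSer' := (PSeries (PS_derive K_coef)).
Notation KSer'' := (PSeries (PS_derive (PS_derive K_coef))).

Lemma ISer_ode (z : R) : z * ISer'' z + ISer' z = ISer z.
Proof.
  rewrite PSeries_euler_operator by apply I_coef_entire. apply PSeries_ext.
  intros n. unfold I_coef. rewrite fact_S_INR. pose proof (INR_S_ge_1 n).
  field. split. apply INR_fact_neq_0. lra.
Qed.

(** The harmonic numbers shift by [1/(n+1)], which produces the inhomogeneous
    term [ISer']. *)
Lemma KSer_ode (z : R) : z * KSer'' z + KSer' z = KSer z + ISer' z.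
Proof.
  rewrite PSeries_euler_operator by apply K_coef_entire.
  rewrite <- PSeries_plus.
  - apply PSeries_ext.
    intros n. unfold PS_plus, PS_derive, K_coef, I_coef, plus. cbn [harmonic].
    change (AbelianMonoid.plus (AbelianGroup.AbelianMonoid R_AbelianGroup)) with Rplus.
    rewrite fact_S_INR. pose proof (INR_S_ge_1 n).
    change_eq_R.
    simpl (AbelianMonoid.plus _ _ _).
    field. split. apply INR_fact_neq_0. lra.
  - apply ex_pseries_entire, K_coef_entire.
  - apply ex_pseries_entire, CV_radius_infinite_derive, I_coef_entire.
Qed.

Lemma is_derive_ISer z : is_derive ISer z (ISer' z).
Proof. apply is_derive_entire, I_coef_entire. Qed.
Lemma is_derive_ISer' z : is_derive ISer' z (ISer'' z).
Proof. apply is_derive_entire, CV_radius_infinite_derive, I_coef_entire. Qed.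
Lemma is_derive_KSer z : is_derive KSer z (KSer' z).
Proof. apply is_derive_entire, K_coef_entire. Qed.
Lemma is_derive_KSer' z : is_derive KSer' z (KSer'' z).
Proof. apply is_derive_entire, CV_radius_infinite_derive, K_coef_entire. Qed.

(** This is the Wronskian of [I_0] and [K_0] cleared of its logarithm and of the
    factor [1/x].  It is entire in [z], so its constant value can be read off at
    [z = 0]; its derivative vanishes by the two differential equations. *)
Lemma ISer_KSer_wronskian (z : R) :
  ISer z ^ 2 - 2 * z * (ISer z * KSer' z - KSer z * ISer' z) = 1.
Proof.
  rewrite (is_derive_0_constant (fun z => ISer z ^ 2 -
     2 * z * (ISer z * KSer' z - KSer z * ISer' z))).
  - rewrite !PSeries_0. unfold I_coef. simpl. field.
  - intros x. pose proof (is_derive_ISer x) as D1. pose proof (is_derive_ISer' x) as D2.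
    pose proof (is_derive_KSer x) as D3. pose proof (is_derive_KSer' x) as D4.
    auto_derive.
    + repeat split; eexists; eassumption.
    + replace (Derive (fun x : R => ISer x) x) with (ISer' x)
        by (symmetry; apply is_derive_unique, D1).
      replace (Derive (fun x : R => ISer' x) x) with (ISer'' x)
        by (symmetry; apply is_derive_unique, D2).
      replace (Derive (fun x : R => KSer x) x) with (KSer' x)
        by (symmetry; apply is_derive_unique, D3).
      replace (Derive (fun x : R => KSer' x) x) with (KSer'' x)
        by (symmetry; apply is_derive_unique, D4).
      pose proof (ISer_ode x) as O1. pose proof (KSer_ode x) as O2.
      transitivity (2 * (ISer x * ISer' x) - 2 * (ISer x * (x * KSer'' x + KSer' x) -
        KSer x * (x * ISer'' x + ISer' x))).
      ring. rewrite O1, O2. ring.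
Qed.

Lemma inv_rising_0 (k : nat) :
  inv_rising 0 k = / INR (fact k) /\ inv_rising_deriv 0 k = - harmonic k / INR (fact k).
Proof.
  induction k as [|k [IH1 IH2]]. simpl; split; field.
  cbn [inv_rising inv_rising_deriv harmonic]. rewrite IH1, IH2, fact_S_INR.
  pose proof (INR_S_ge_1 k). pose proof (INR_fact_neq_0 k).
  split; field; lra.
Qed.

Lemma inv_rising_1 (k : nat) :
  inv_rising 1 k = / INR (fact (S k)) /\
  inv_rising_deriv 1 k = (1 - harmonic (S k)) / INR (fact (S k)).
Proof.
  induction k as [|k [IH1 IH2]]. simpl; split; field.
  cbn [inv_rising inv_rising_deriv]. rewrite IH1, IH2, (fact_S_INR (S k)).
  cbn [harmonic]. rewrite (S_INR (S k)).
  pose proof (INR_S_ge_1 k). pose proof (INR_fact_neq_0 (S k)).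
  split; field; lra.
Qed.

Lemma hyper01_0 (z : R) : hyper01 z 0 = ISer z /\ hyper01_deriv z 0 = - KSer z.
Proof.
  split; unfold hyper01, hyper01_deriv, PSeries; try rewrite <- Series_opp;
    apply Series_ext; intros k; destruct (inv_rising_0 k) as [E1 E2];
    rewrite ?E1, ?E2; unfold I_coef, K_coef; field; apply INR_fact_neq_0.
Qed.

Lemma hyper01_1 (z : R) :
  hyper01 z 1 = ISer' z /\ hyper01_deriv z 1 = ISer' z - KSer' z.
Proof.
  split.
  - apply Series_ext; intros k. destruct (inv_rising_1 k) as [E1 E2].
    rewrite E1. unfold PS_derive, I_coef. rewrite fact_S_INR.
    pose proof (INR_S_ge_1 k). pose proof (INR_fact_neq_0 k). field; lra.
  - rewrite <- PSeries_minus.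
    + apply Series_ext; intros k. destruct (inv_rising_1 k) as [E1 E2].
      change (PS_minus (PS_derive I_coef) (PS_derive K_coef) k) with
        (PS_derive I_coef k - PS_derive K_coef k).
      rewrite E2. unfold PS_derive, I_coef, K_coef. rewrite fact_S_INR.
      pose proof (INR_S_ge_1 k). pose proof (INR_fact_neq_0 k). field; lra.
    + apply ex_pseries_entire, CV_radius_infinite_derive, I_coef_entire.
    + apply ex_pseries_entire, CV_radius_infinite_derive, K_coef_entire.
Qed.

Lemma rgamma_2 : rgamma (1 + 1) = 1.
Proof.
  destruct (rgamma_shift_up 1) as [_ E]. lra.
  replace 1 with (0 + 1) by ring. apply gauss_converges_0. rewrite Rabs_R0; lra.
  rewrite E, rgamma_1. field.
Qed.

Lemma besselI_0_eq (x : R) : 0 < x -> besselI 0 x = ISer ((x / 2) ^ 2).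
Proof.
  intros Hx. rewrite besselI_factor; auto; try lra.
  - rewrite Rplus_0_l, rgamma_1, Rpower_O by lra.
    rewrite (proj1 (hyper01_0 _)). ring.
  - apply gauss_converges_0. rewrite Rabs_R0; lra.
Qed.

Lemma besselI_1_eq (x : R) : 0 < x -> besselI 1 x = x / 2 * ISer' ((x / 2) ^ 2).
Proof.
  intros Hx. rewrite besselI_factor; auto; try lra.
  - rewrite rgamma_2, Rpower_1 by lra.
    rewrite (proj1 (hyper01_1 _)). ring.
  - replace 1 with (0 + 1) at 1 by ring. apply gauss_converges_1. rewrite Rabs_R0; lra.
Qed.

Lemma is_derive_besselI_order_0 (x : R) : 0 < x ->
  is_derive (fun mu => besselI mu x) 0
   ((ln (x / 2) + euler_gamma) * ISer ((x / 2) ^ 2) - KSer ((x / 2) ^ 2)).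
Proof.
  intros Hx.
  destruct (hyper01_0 ((x / 2) ^ 2)) as [E1 E2].
  pose proof (is_derive_besselI_order 0 x euler_gamma Hx (Rle_refl 0)) as D.
  rewrite E1, E2, Rplus_0_l, rgamma_1, Rpower_O in D by lra.
  match type of D with _ -> _ -> is_derive _ _ ?u => match goal with |- is_derive _ _ ?v =>
    replace v with u by ring end end.
  apply D.
  - apply locally_Rabs with (1 / 2). lra. intros y Hy. apply gauss_converges_0.
    rewrite Rminus_0_r in Hy. lra.
  - apply is_derive_rgamma_plus_1_at_0.
Qed.

Lemma is_derive_besselI_order_1 (x : R) : 0 < x ->
  is_derive (fun mu => besselI mu x) 1
   (x / 2 * ((ln (x / 2) + euler_gamma) * ISer' ((x / 2) ^ 2) - KSer' ((x / 2) ^ 2))).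
Proof.
  intros Hx.
  destruct (hyper01_1 ((x / 2) ^ 2)) as [E1 E2].
  pose proof (is_derive_besselI_order 1 x (euler_gamma - 1) Hx Rle_0_1) as D.
  rewrite E1, E2, rgamma_2, Rpower_1 in D by lra.
  match type of D with _ -> _ -> is_derive _ _ ?u => match goal with |- is_derive _ _ ?v =>
    replace v with u by ring end end.
  apply D.
  - apply locally_Rabs with (1 / 2). lra. intros y Hy.
    replace (y + 1) with (y - 1 + 1 + 1) by ring. apply gauss_converges_1. lra.
  - apply is_derive_rgamma_plus_1_at_1.
Qed.

Lemma besselK_0_eq (x : R) : 0 < x ->
  besselK 0 x = KSer ((x / 2) ^ 2) - (ln (x / 2) + euler_gamma) * ISer ((x / 2) ^ 2).
Proof.
  intros Hx. pose proof (is_derive_besselI_order_0 x Hx) as D.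
  set (d := (ln (x / 2) + euler_gamma) * ISer ((x / 2) ^ 2) - KSer ((x / 2) ^ 2)) in *.
  rewrite (besselK_of_derive 0 x (- 1 * d - d) 1); try lra.
  - unfold d. field.
  - apply (is_derive_minus (fun mu => besselI (- mu) x) (fun mu => besselI mu x)); auto.
    apply (is_derive_comp (fun mu => besselI mu x) (fun mu => - mu)).
    + rewrite Ropp_0. exact D.
    + auto_derive; auto.
  - rewrite Ropp_0. ring.
  - rewrite Rmult_0_l. apply sin_0.
  - rewrite Rmult_0_l. apply cos_0.
Qed.

(** The quotient involves [I_(-mu)] with [mu] near 1.  The recurrence rewrites it
    as [I_(2-mu) + (2/x) (1-mu) I_(1-mu)], whose derivative at [mu = 1] only
    needs the order-derivative at 1 and the value [I_0]. *)
Lemma besselK_1_eq (x : R) : 0 < x ->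
  besselK 1 x = x / 2 * ((ln (x / 2) + euler_gamma) * ISer' ((x / 2) ^ 2)
                         - KSer' ((x / 2) ^ 2)) + ISer ((x / 2) ^ 2) / x.
Proof.
  intros Hx. pose proof (is_derive_besselI_order_1 x Hx) as D1.
  pose proof (is_derive_besselI_order_0 x Hx) as D0.
  set (d := x / 2 * _) in *. set (d0 := _ - _) in D0.
  assert (HR : forall e, Rabs e < 1 / 2 ->
    besselI (e - 1) x = besselI (e + 1) x + 2 * e / x * besselI e x).
  { intros e He. apply besselI_recurrence; auto. lra. }
  rewrite (besselK_of_derive 1 x (- 2 * d - 2 / x * besselI 0 x) (- 1)); try lra.
  - rewrite besselI_0_eq by auto. field. lra.
  - apply is_derive_ext_loc with (fun mu => besselI (2 - mu) x +
       2 / x * ((1 - mu) * besselI (1 - mu) x) - besselI mu x).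
    + apply locally_Rabs with (1 / 2). lra. intros mu Hm.
      assert (He : Rabs (1 - mu) < 1 / 2) by (rewrite Rabs_minus_sym; auto).
      specialize (HR (1 - mu) He).
      replace (1 - mu - 1) with (- mu) in HR by ring. rewrite HR.
      replace (1 - mu + 1) with (2 - mu) by ring.
      change_eq_R. field. lra.
    + assert (D2 : is_derive (fun mu => besselI (2 - mu) x) 1 (- 1 * d)).
      { apply (is_derive_comp (fun mu => besselI mu x) (fun mu => 2 - mu)).
        replace (2 - 1) with 1 by ring. exact D1. auto_derive; auto. }
      assert (D3 : is_derive (fun mu => besselI (1 - mu) x) 1 (- 1 * d0)).
      { apply (is_derive_comp (fun mu => besselI mu x) (fun mu => 1 - mu)).
        replace (1 - 1) with 0 by ring. exact D0. auto_derive; auto. }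
      assert (DC : forall (u v w : R -> R) u' v' w' c,
        is_derive u 1 u' -> is_derive v 1 v' -> is_derive w 1 w' ->
        is_derive (fun mu => u mu + c * ((1 - mu) * v mu) - w mu) 1
          (u' - c * v 1 - w')).
      { clear. intros u v w u' v' w' c Hu Hv Hw. auto_derive.
        - repeat split; eexists; eassumption.
        - replace (Derive (fun x : R => u x) 1) with u'
            by (symmetry; apply is_derive_unique, Hu).
          replace (Derive (fun x : R => w x) 1) with w'
            by (symmetry; apply is_derive_unique, Hw).
          ring. }
      replace (-2 * d - 2 / x * besselI 0 x) with
        (-1 * d - 2 / x * besselI (1 - 1) x - d)
        by (replace (1 - 1) with 0 by ring; ring).
      apply (DC (fun mu => besselI (2 - mu) x) (fun mu => besselI (1 - mu) x)
        (fun mu => besselI mu x) _ (-1 * d0)); auto.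
  - specialize (HR 0). rewrite Rabs_R0, Rminus_0_l, Rplus_0_l in HR. rewrite HR by lra.
    field. lra.
  - rewrite Rmult_1_l. apply sin_PI.
  - rewrite Rmult_1_l. apply cos_PI.
Qed.

(** * The Bessel system and its Wronskian *)

Lemma is_derive_half_square (g : R -> R) (g' x : R) :
  is_derive g ((x / 2) ^ 2) g' ->
  is_derive (fun y => g ((y / 2) ^ 2)) x (x / 2 * g').
Proof.
  intros D. auto_derive.
  - eexists; exact D.
  - change (x * / 2) with (x / 2). change (x / 2 * (x / 2 * 1)) with ((x / 2) ^ 2).
    derive_rewrite D. field.
Qed.

Lemma is_derive_besselI_0 (x : R) : 0 < x -> is_derive (besselI 0) x (besselI 1 x).
Proof.
  intros Hx. apply is_derive_ext_loc with (fun y => ISer ((y / 2) ^ 2)).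
  - apply locally_pos; auto. intros y Hy. symmetry. apply besselI_0_eq; auto.
  - rewrite besselI_1_eq by auto. apply is_derive_half_square, is_derive_ISer.
Qed.

Lemma is_derive_besselI_1 (x : R) : 0 < x ->
  is_derive (besselI 1) x (besselI 0 x - besselI 1 x / x).
Proof.
  intros Hx. apply is_derive_ext_loc with (fun y => y / 2 * ISer' ((y / 2) ^ 2)).
  - apply locally_pos; auto. intros y Hy. symmetry. apply besselI_1_eq; auto.
  - rewrite besselI_1_eq, besselI_0_eq by auto.
    pose proof (is_derive_half_square _ _ x (is_derive_ISer' ((x / 2) ^ 2))) as D.
    pose proof (ISer_ode ((x / 2) ^ 2)) as O.
    set (z := (x / 2) ^ 2) in *.
    assert (E : ISer z - x / 2 * ISer' z / x = / 2 * ISer' z + x / 2 * (x / 2 * ISer'' z)).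
    { rewrite <- O. unfold z. field. lra. }
    rewrite E.
    apply (is_derive_mult (fun y => y / 2) (fun y => ISer' ((y / 2) ^ 2)) x (/ 2)); auto.
    + auto_derive; auto; field.
    + intros; apply Rmult_comm.
Qed.

Lemma is_derive_besselK_0 (x : R) : 0 < x -> is_derive (besselK 0) x (- besselK 1 x).
Proof.
  intros Hx. apply is_derive_ext_loc with (fun y =>
    KSer ((y / 2) ^ 2) - (ln (y / 2) + euler_gamma) * ISer ((y / 2) ^ 2)).
  - apply locally_pos; auto. intros y Hy. symmetry. apply besselK_0_eq; auto.
  - rewrite besselK_1_eq by auto.
    pose proof (is_derive_half_square _ _ x (is_derive_ISer ((x / 2) ^ 2))) as D1.
    pose proof (is_derive_half_square _ _ x (is_derive_KSer ((x / 2) ^ 2))) as D2.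
    set (u := fun y : R => ISer ((y / 2) ^ 2)). set (v := fun y : R => KSer ((y / 2) ^ 2)).
    change (is_derive u x (x / 2 * ISer' ((x / 2) ^ 2))) in D1.
    change (is_derive v x (x / 2 * KSer' ((x / 2) ^ 2))) in D2.
    change (is_derive (fun y => v y - (ln (y / 2) + euler_gamma) * u y) x
     (- (x / 2 * ((ln (x / 2) + euler_gamma) * ISer' ((x / 2) ^ 2) - KSer' ((x / 2) ^ 2)) +
       u x / x))).
    auto_derive.
    + repeat split; try (eexists; eassumption). lra.
    + derive_rewrite D1. derive_rewrite D2. change (x * / 2) with (x / 2). field. lra.
Qed.

Lemma is_derive_besselK_1 (x : R) : 0 < x ->
  is_derive (besselK 1) x (- besselK 0 x - besselK 1 x / x).
Proof.
  intros Hx. apply is_derive_ext_loc with (fun y =>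
    y / 2 * ((ln (y / 2) + euler_gamma) * ISer' ((y / 2) ^ 2)
                         - KSer' ((y / 2) ^ 2)) + ISer ((y / 2) ^ 2) / y).
  - apply locally_pos; auto. intros y Hy. symmetry. apply besselK_1_eq; auto.
  - rewrite besselK_1_eq, besselK_0_eq by auto.
    pose proof (is_derive_half_square _ _ x (is_derive_ISer ((x / 2) ^ 2))) as D1.
    pose proof (is_derive_half_square _ _ x (is_derive_ISer' ((x / 2) ^ 2))) as D2.
    pose proof (is_derive_half_square _ _ x (is_derive_KSer' ((x / 2) ^ 2))) as D3.
    pose proof (ISer_ode ((x / 2) ^ 2)) as O1. pose proof (KSer_ode ((x / 2) ^ 2)) as O2.
    set (u := fun y : R => ISer ((y / 2) ^ 2)).
    set (u' := fun y : R => ISer' ((y / 2) ^ 2)).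
    set (v' := fun y : R => KSer' ((y / 2) ^ 2)).
    change (is_derive u x (x / 2 * ISer' ((x / 2) ^ 2))) in D1.
    change (is_derive u' x (x / 2 * ISer'' ((x / 2) ^ 2))) in D2.
    change (is_derive v' x (x / 2 * KSer'' ((x / 2) ^ 2))) in D3.
    apply (is_derive_ext (fun y =>
      y / 2 * ((ln (y / 2) + euler_gamma) * u' y - v' y) + u y / y)).
    reflexivity.
    auto_derive.
    + repeat split; try (eexists; eassumption); lra.
    + derive_rewrite D1. derive_rewrite D2. derive_rewrite D3.
      change (x * / 2) with (x / 2). unfold u, u', v'.
      set (z := (x / 2) ^ 2) in *.
      set (L := ln (x / 2) + euler_gamma).
      replace (KSer z) with (z * KSer'' z + KSer' z - ISer' z) by lra.
      rewrite <- O1. unfold z. field. lra.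
Qed.

(** The logarithms in [K_0] and [K_1] cancel. *)
Lemma besselI_besselK_wronskian (x : R) : 0 < x ->
  x * (besselI 0 x * besselK 1 x + besselI 1 x * besselK 0 x) = 1.
Proof.
  intros Hx. rewrite besselI_0_eq, besselI_1_eq, besselK_0_eq, besselK_1_eq by auto.
  rewrite <- (ISer_KSer_wronskian ((x / 2) ^ 2)). field. lra.
Qed.

Lemma modified_bessel_solution_I_K (p q : R) :
  modified_bessel_solution (fun t => p * besselI 0 t + q * besselK 0 t).
Proof.
  set (f := fun t => p * besselI 0 t + q * besselK 0 t).
  set (f1 := fun t => p * besselI 1 t - q * besselK 1 t).
  assert (D1 : forall t, 0 < t -> is_derive f t (f1 t)).
  { intros t Ht. unfold f, f1.
    pose proof (is_derive_besselI_0 t Ht) as DI. pose proof (is_derive_besselK_0 t Ht) as DK.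
    auto_derive. repeat split; eexists; eassumption.
    derive_rewrite DI. derive_rewrite DK. ring. }
  assert (D2 : forall t, 0 < t -> is_derive (Derive f) t
      (f t - f1 t / t)).
  { intros t Ht. apply is_derive_ext_loc with f1.
    - apply locally_pos; auto. intros y Hy. symmetry. apply is_derive_unique, D1; auto.
    - unfold f, f1.
      pose proof (is_derive_besselI_1 t Ht) as DI. pose proof (is_derive_besselK_1 t Ht) as DK.
      auto_derive. repeat split; eexists; eassumption.
      derive_rewrite DI. derive_rewrite DK. field. lra. }
  intros t Ht. repeat split.
  - eexists; apply D1; auto.
  - eexists; apply D2; auto.
  - rewrite (is_derive_unique _ _ _ (D2 t Ht)), (is_derive_unique _ _ _ (D1 t Ht)).
    field. lra.
Qed.

(** * The exponential generating function *)

Lemma exp_partial_sum_le (y : R) (n : nat) : 0 <= y ->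
  sum_f_R0 (fun k => y ^ (n - k) / INR (fact (n - k))) n <= exp y.
Proof.
  intros Hy.
  replace (sum_f_R0 (fun k => y ^ (n - k) / INR (fact (n - k))) n)
    with (sum_n (fun k => / INR (fact k) * y ^ k) n).
  - assert (HE : is_series (fun k => / INR (fact k) * y ^ k) (exp y)).
    { apply is_pseries_R, is_exp_Reals. }
    apply (is_lim_seq_incr_compare (sum_n (fun k => / INR (fact k) * y ^ k)) (exp y) HE).
    intros m. rewrite sum_Sn.
    match goal with |- ?u <= plus ?u ?v => change (u <= u + v) end.
    rewrite <- (Rplus_0_r (sum_n _ m)) at 1. apply Rplus_le_compat_l.
    apply Rmult_le_pos. left. apply Rinv_0_lt_compat, INR_fact_lt_0. apply pow_le; auto.
  - induction n as [|n IH].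
    + rewrite sum_O. simpl. field.
    + rewrite sum_Sn, IH, (decomp_sum _ (S n)) by lia.
      change (pred (S n)) with n. rewrite Rplus_comm.
      replace (S n - 0)%nat with (S n) by lia.
      unfold plus; simpl AbelianMonoid.plus. f_equal.
      unfold Rdiv. ring.
Qed.

Definition egf_coef (a : nat -> R) (n : nat) : R := a n / INR (fact n).

(** The binomial convolution of [a] becomes a Cauchy product with the series of
    [exp (2x)] after division by [n!]. *)
Lemma egf_coef_rec (a : nat -> R) (Ha : two_bell a) (n : nat) :
  PS_derive (PS_derive (egf_coef a)) n =
  PS_mult (egf_coef a) (fun j => 2 ^ j / INR (fact j)) n.
Proof.
  unfold PS_derive, PS_mult, egf_coef. rewrite (Ha n), !fact_S_INR.
  pose proof (INR_S_ge_1 n). pose proof (INR_S_ge_1 (S n)). pose proof (INR_fact_neq_0 n).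
  transitivity (/ INR (fact n) *
     sum_f_R0 (fun k => Binomial.C n k * 2 ^ (n - k) * a k) n).
  - field. lra.
  - rewrite scal_sum. apply sum_eq. intros k _. unfold Binomial.C.
    pose proof (INR_fact_neq_0 k). pose proof (INR_fact_neq_0 (n - k)). field. auto.
Qed.

(** With all terms scaled by powers of [r], the convolution is at most
    [M * exp (2r)], and the coefficient
    [(n+1)(n+2)] on the left beats [r^2 * exp (2r)] as soon as [n] does. *)
Lemma egf_coef_step (a : nat -> R) (Ha : two_bell a) (r M : R) (n : nat) : 0 <= r ->
  (forall k, (k <= n)%nat -> Rabs (egf_coef a k * r ^ k) <= M) ->
  r ^ 2 * exp (2 * r) <= INR n ->
  Rabs (egf_coef a (S (S n)) * r ^ S (S n)) <= M.
Proof.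
  intros Hr HM Hn.
  assert (M0 : 0 <= M) by (eapply Rle_trans; [apply Rabs_pos | apply (HM 0%nat); lia]).
  pose proof (egf_coef_rec a Ha n) as E. unfold PS_derive in E.
  pose proof (INR_S_ge_1 n) as H1. pose proof (INR_S_ge_1 (S n)) as H2.
  assert (E2 : INR (S n) * INR (S (S n)) * (egf_coef a (S (S n)) * r ^ S (S n)) =
    r ^ 2 * sum_f_R0 (fun k => (egf_coef a k * r ^ k) *
         ((2 * r) ^ (n - k) / INR (fact (n - k)))) n).
  { transitivity (r ^ S (S n) * (INR (S n) * (INR (S (S n)) * egf_coef a (S (S n))))). ring.
    rewrite E. unfold PS_mult. rewrite !scal_sum. apply sum_eq. intros k Hk.
    replace (r ^ S (S n)) with (r ^ 2 * (r ^ (n - k) * r ^ k)).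
    rewrite Rpow_mult_distr. field. apply INR_fact_neq_0.
    rewrite <- !pow_add. f_equal. lia. }
  assert (E3 : INR (S n) * INR (S (S n)) * Rabs (egf_coef a (S (S n)) * r ^ S (S n))
       <= r ^ 2 * exp (2 * r) * M).
  { rewrite <- (Rabs_pos_eq (INR (S n) * INR (S (S n)))) by nra.
    rewrite <- Rabs_mult, E2, Rabs_mult, Rabs_pos_eq, Rmult_assoc by apply pow2_ge_0.
    apply Rmult_le_compat_l. apply pow2_ge_0.
    eapply Rle_trans. apply Rsum_abs.
    eapply Rle_trans.
    2: apply Rmult_le_compat_r; auto; apply (exp_partial_sum_le (2 * r) n); lra.
    rewrite (Rmult_comm _ M), scal_sum. apply sum_Rle. intros k Hk.
    assert (0 <= (2 * r) ^ (n - k) / INR (fact (n - k))).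
    { apply Rle_mult_inv_pos. apply pow_le; lra. apply INR_fact_lt_0. }
    rewrite Rabs_mult, (Rabs_pos_eq (_ / _)) by auto. rewrite Rmult_comm.
    apply Rmult_le_compat_l; auto. }
  rewrite !S_INR in *.
  pose proof (Rabs_pos (egf_coef a (S (S n)) * r ^ S (S n))).
  pose proof (pos_INR n).
  assert (r ^ 2 * exp (2 * r) * M <= INR n * M) by (apply Rmult_le_compat_r; auto).
  apply Rnot_lt_le. intros HH.
  assert (INR n * M <= (INR n + 1) * (INR n + 1 + 1) * M) by (apply Rmult_le_compat_r; nra).
  assert ((INR n + 1) * (INR n + 1 + 1) * M <
     (INR n + 1) * (INR n + 1 + 1) * Rabs (egf_coef a (S (S n)) * r ^ S (S n)))
   by (apply Rmult_lt_compat_l; nra).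
  lra.
Qed.

Lemma finite_bound (u : nat -> R) (N : nat) : exists M, forall k, (k <= N)%nat -> u k <= M.
Proof.
  induction N as [|N [M HM]].
  - exists (u 0%nat). intros k Hk. replace k with 0%nat by lia. lra.
  - exists (Rmax M (u (S N))). intros k Hk.
    destruct (Nat.eq_dec k (S N)) as [->|]. apply Rmax_r.
    eapply Rle_trans. apply HM; lia. apply Rmax_l.
Qed.

(** For every radius [r] the terms stay bounded: finitely many of them are
    bounded trivially, and [egf_coef_step] propagates the bound. *)
Lemma egf_coef_entire (a : nat -> R) (Ha : two_bell a) : CV_radius (egf_coef a) = p_infty.
Proof.
  assert (HB : forall r, 0 <= r -> exists M, forall n, Rabs (egf_coef a n * r ^ n) <= M).
  { intros r Hr.
    assert (P : 0 <= r ^ 2 * exp (2 * r)).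
    { apply Rmult_le_pos. apply pow2_ge_0. left; apply exp_pos. }
    destruct (nfloor_ex _ P) as [N [_ HN]].
    destruct (finite_bound (fun k => Rabs (egf_coef a k * r ^ k)) (S (S N))) as [M HM].
    exists M. intros n. induction n as [n IH] using (well_founded_induction Nat.lt_wf_0).
    destruct (Nat.le_gt_cases n (S (S N))) as [Hn|Hn]. auto.
    destruct n as [|[|n]]; try lia. apply (egf_coef_step a Ha); auto.
    - intros k Hk. apply IH. lia.
    - assert (N + 1 <= n)%nat by lia. apply le_INR in H. rewrite plus_INR in H.
      simpl in H. lra. }
  destruct (CV_radius_bounded (egf_coef a)) as [UB _].
  pose proof (CV_radius_ge_0 (egf_coef a)) as H0.
  destruct (CV_radius (egf_coef a)) as [r| |] eqn:E; auto.
  - simpl in H0. specialize (UB (r + 1)). simpl in UB.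
    assert (r + 1 <= r) by (apply UB, HB; lra). lra.
  - destruct H0.
Qed.

Lemma is_derive_egf (a : nat -> R) (Ha : two_bell a) (x : R) :
  is_derive (PSeries (egf_coef a)) x (PSeries (PS_derive (egf_coef a)) x).
Proof. apply is_derive_entire, egf_coef_entire, Ha. Qed.

Lemma exp_pow_entire : CV_radius (fun j => 2 ^ j / INR (fact j)) = p_infty.
Proof.
  apply CV_radius_infinite_of_ex_series. intros x Hx. exists (exp (2 * x)).
  apply is_series_ext with (fun n => / INR (fact n) * (2 * x) ^ n).
  2: apply is_pseries_R, is_exp_Reals.
  intros n. change_eq_R.
  rewrite Rpow_mult_distr. unfold Rdiv. ring.
Qed.

Lemma is_derive_egf_derivative (a : nat -> R) (Ha : two_bell a) (x : R) :
  is_derive (PSeries (PS_derive (egf_coef a))) x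
    (exp x ^ 2 * PSeries (egf_coef a) x).
Proof.
  replace (exp x ^ 2 * PSeries (egf_coef a) x) with
    (PSeries (PS_derive (PS_derive (egf_coef a))) x).
  apply is_derive_entire, CV_radius_infinite_derive, egf_coef_entire, Ha.
  rewrite (PSeries_ext _ _ x (egf_coef_rec a Ha)), PSeries_mult.
  - rewrite Rmult_comm. f_equal.
    replace (exp x ^ 2) with (exp (2 * x)).
    + rewrite (exp_Reals (2 * x)). apply Series_ext. intros n.
      rewrite Rpow_mult_distr. unfold Rdiv. ring.
    + replace (2 * x) with (x + x) by ring. rewrite exp_plus. ring.
  - rewrite (egf_coef_entire a Ha). exact I.
  - rewrite exp_pow_entire. exact I.
Qed.

Lemma egf_initial_values (a : nat -> R) :
  PSeries (egf_coef a) 0 = a 0%nat /\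
  PSeries (PS_derive (egf_coef a)) 0 = a 1%nat.
Proof. rewrite !PSeries_0. unfold PS_derive, egf_coef. simpl. split; field. Qed.

(** If [u] solves the modified Bessel equation with derivative [v], then
    [u (exp x)] solves [y'' = exp(2x) y], and so does the generating function;
    the left-hand side is their Wronskian, evaluated at 0 on the right. *)
Lemma egf_wronskian_constant (a : nat -> R) (Ha : two_bell a) (u v : R -> R) :
  (forall t, 0 < t -> is_derive u t (v t)) ->
  (forall t, 0 < t -> is_derive v t (u t - v t / t)) ->
  forall x,
    PSeries (egf_coef a) x * (exp x * v (exp x))
      - PSeries (PS_derive (egf_coef a)) x * u (exp x)
    = a 0%nat * v 1 - a 1%nat * u 1.
Proof.
  intros Du Dv x.
  rewrite (is_derive_0_constant (fun x =>
    PSeries (egf_coef a) x * (exp x * v (exp x))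
      - PSeries (PS_derive (egf_coef a)) x * u (exp x))).
  - destruct (egf_initial_values a) as [-> ->]. rewrite exp_0. ring.
  - clear x. intros x. pose proof (exp_pos x) as P.
    specialize (Du _ P). specialize (Dv _ P).
    pose proof (is_derive_egf a Ha x) as DA.
    pose proof (is_derive_egf_derivative a Ha x) as DA'.
    auto_derive. repeat split; eexists; eassumption.
    derive_rewrite Du. derive_rewrite Dv. derive_rewrite DA. derive_rewrite DA'.
    field. lra.
Qed.

(** Cramer's rule: the two Wronskians of the generating function are linear in
    it and its derivative, with determinant 1. *)
Lemma egf_eq_bessel (a : nat -> R) (Ha : two_bell a) (x : R) :
  PSeries (egf_coef a) x = (a 0%nat * besselK 1 1 + a 1%nat * besselK 0 1) * besselI 0 (exp x)
      + (a 0%nat * besselI 1 1 - a 1%nat * besselI 0 1) * besselK 0 (exp x).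
Proof.
  pose proof (exp_pos x) as P.
  pose proof (egf_wronskian_constant a Ha _ _ is_derive_besselI_0 is_derive_besselI_1 x) as WI.
  assert (WK : PSeries (egf_coef a) x * (exp x * - besselK 1 (exp x))
            - PSeries (PS_derive (egf_coef a)) x * besselK 0 (exp x)
          = a 0%nat * - besselK 1 1 - a 1%nat * besselK 0 1).
  { apply (egf_wronskian_constant a Ha (besselK 0) (fun t => - besselK 1 t) is_derive_besselK_0).
    intros t Ht. pose proof (is_derive_opp _ _ _ (is_derive_besselK_1 t Ht)) as D.
    replace (besselK 0 t - - besselK 1 t / t) with
      (- (- besselK 0 t - besselK 1 t / t)) by (field; lra). exact D. }
  pose proof (besselI_besselK_wronskian _ P) as W.
  replace (a 0%nat * besselK 1 1 + a 1%nat * besselK 0 1) with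
    (- (PSeries (egf_coef a) x * (exp x * - besselK 1 (exp x))
        - PSeries (PS_derive (egf_coef a)) x * besselK 0 (exp x))) by lra.
  rewrite <- WI.
  transitivity (PSeries (egf_coef a) x * (exp x * (besselI 0 (exp x) * besselK 1 (exp x) +
      besselI 1 (exp x) * besselK 0 (exp x)))).
  - rewrite W. ring.
  - ring.
Qed.

(** Value and derivative at [t = 1] give a linear system with determinant the
    Wronskian. *)
Lemma bessel_pair_independent (c d : R) :
  (forall x, c * besselI 0 (exp x) + d * besselK 0 (exp x) = 0) -> c = 0 /\ d = 0.
Proof.
  intros H.
  pose proof (is_derive_besselI_0 1 Rlt_0_1) as DI.
  pose proof (is_derive_besselK_0 1 Rlt_0_1) as DK.
  pose proof (besselI_besselK_wronskian 1 Rlt_0_1) as W.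
  assert (E0 : c * besselI 0 1 + d * besselK 0 1 = 0) by (rewrite <- exp_0; apply H).
  assert (D : is_derive (fun t => c * besselI 0 t + d * besselK 0 t) 1 0).
  { apply is_derive_ext_loc with (fun _ => 0).
    - apply locally_pos. lra. intros t Ht. rewrite <- (exp_ln t Ht). symmetry. apply H.
    - auto_derive; auto. }
  assert (E1 : c * besselI 1 1 - d * besselK 1 1 = 0).
  { rewrite <- (is_derive_unique _ _ _ D). symmetry. apply is_derive_unique.
    auto_derive. repeat split; eexists; eassumption.
    derive_rewrite DI. derive_rewrite DK. ring. }
  split.
  - replace c with (c * (1 * (besselI 0 1 * besselK 1 1 + besselI 1 1 * besselK 0 1)))
      by (rewrite W; ring).
    transitivity (besselK 1 1 * (c * besselI 0 1 + d * besselK 0 1) +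
                  besselK 0 1 * (c * besselI 1 1 - d * besselK 1 1)). ring.
    rewrite E0, E1. ring.
  - replace d with (d * (1 * (besselI 0 1 * besselK 1 1 + besselI 1 1 * besselK 0 1)))
      by (rewrite W; ring).
    transitivity (besselI 1 1 * (c * besselI 0 1 + d * besselK 0 1) -
                  besselI 0 1 * (c * besselI 1 1 - d * besselK 1 1)). ring.
    rewrite E0, E1. ring.
Qed.

(** * Numerical values *)

(** The derivative of [ln (1+x) - ln (1-x)] minus that of its Taylor polynomial
    of degree 17 is [2 x^18 / (1-x^2)], which is nonnegative and, for
    [x <= 1/3], at most [9/4 * x^18]. *)
Lemma ln_2_bounds : 0.69314718045 <= ln 2 <= 0.69314718057.
Proof.
  set (p := fun x : R => 2 * (x + x ^ 3 / 3 + x ^ 5 / 5 + x ^ 7 / 7 + x ^ 9 / 9 + x ^ 11 / 11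
     + x ^ 13 / 13 + x ^ 15 / 15 + x ^ 17 / 17)).
  assert (E : ln 2 = ln (1 + 1 / 3) - ln (1 - 1 / 3)).
  { rewrite <- ln_div by lra. f_equal. field. }
  rewrite E. split.
  - assert (H : 0 <= ln (1 + 1 / 3) - ln (1 - 1 / 3) - p (1 / 3)).
    { apply (nonneg_of_derive_nonneg (fun x => ln (1 + x) - ln (1 - x) - p x)
        (fun x => 2 * x ^ 18 / ((1 + x) * (1 - x)))); try lra.
      - unfold p. rewrite Rplus_0_r, Rminus_0_r. field.
      - intros t Ht. unfold p. auto_derive. lra. field. lra.
      - intros t Ht. apply Rle_mult_inv_pos. 2: nra.
        apply Rmult_le_pos. lra. apply pow_le; lra. }
    unfold p in H. lra.
  - assert (H : 0 <= p (1 / 3) + 9 / 76 * (1 / 3) ^ 19 - (ln (1 + 1 / 3) - ln (1 - 1 / 3))).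
    { apply (nonneg_of_derive_nonneg
         (fun x => p x + 9 / 76 * x ^ 19 - (ln (1 + x) - ln (1 - x)))
        (fun x => x ^ 18 * (1 - 9 * x ^ 2) / (4 * ((1 + x) * (1 - x))))); try lra.
      - unfold p. rewrite Rplus_0_r, Rminus_0_r. field.
      - intros t Ht. unfold p. auto_derive. lra. field. lra.
      - intros t Ht. apply Rle_mult_inv_pos. 2: nra.
        apply Rmult_le_pos. apply pow_le; lra. nra. }
    unfold p in H. lra.
Qed.

(** At [n = 32] the two Euler-Maclaurin truncations differ by less than 1e-8,
    and [ln 32] is a multiple of [ln 2]. *)
Lemma ln_2_minus_gamma_bounds :
  0.115931504 <= ln 2 - euler_gamma <= 0.115931526.
Proof.
  destruct ln_2_bounds as [L1 L2].
  destruct (euler_gamma_bounds 32) as [G1 G2]. lia.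
  unfold euler_lower, euler_upper in *.
  assert (E : ln (INR 32) = 5 * ln 2).
  { replace (INR 32) with (2 ^ 5) by (simpl; ring). rewrite ln_pow by lra. simpl. ring. }
  rewrite E in *. cbn [harmonic] in *. rewrite !INR_IZR_INZ in *. simpl Z.of_nat in *.
  split; lra.
Qed.

(** The tail is dominated by a geometric series with ratio 1/4, divided by
    [(n+1)!]. *)
Lemma PSeries_quarter_bounds (b : nat -> R) (n : nat) :
  (forall k, 0 <= b k * INR (fact k) <= 1) ->
  sum_f_R0 (fun k => b k * (1 / 4) ^ k) n <= PSeries b (1 / 4)
    <= sum_f_R0 (fun k => b k * (1 / 4) ^ k) n
       + (1 / 4) ^ S n * (4 / 3 * / INR (fact (S n))).
Proof.
  intros Hb.
  assert (Hb0 : forall k, 0 <= b k <= / INR (fact k)).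
  { intros k. pose proof (INR_fact_lt_0 k). destruct (Hb k). split.
    - apply Rmult_le_reg_r with (INR (fact k)); lra.
    - apply Rmult_le_reg_r with (INR (fact k)); auto. rewrite Rinv_l; lra. }
  assert (Hp : forall k, 0 < (1 / 4) ^ k) by (intros; apply pow_lt; lra).
  rewrite (PSeries_decr_n b n).
  2: { apply ex_pseries_entire, CV_radius_infinite_of_fact_bound. intros k.
       destruct (Hb k). rewrite Rabs_pos_eq; auto. }
  assert (Ex : ex_series (fun k => / INR (fact (S n)) * (1 / 4) ^ k)).
  { apply (ex_series_scal_l (/ INR (fact (S n))) (fun k => (1 / 4) ^ k)).
    apply ex_series_geom. rewrite Rabs_pos_eq; lra. }
  assert (Ht : forall k, 0 <= PS_decr_n b (S n) k * (1 / 4) ^ k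
              <= / INR (fact (S n)) * (1 / 4) ^ k).
  { intros k. unfold PS_decr_n. destruct (Hb0 (S n + k)%nat) as [B1 B2].
    specialize (Hp k).
    assert (/ INR (fact (S n + k)) <= / INR (fact (S n))).
    { apply Rinv_le_contravar. apply INR_fact_lt_0. apply le_INR, fact_le. lia. }
    split. apply Rmult_le_pos; lra. apply Rmult_le_compat_r; lra. }
  assert (T0 : 0 <= PSeries (PS_decr_n b (S n)) (1 / 4)).
  { rewrite <- (PSeries_const_0 (1 / 4)). apply Series_le.
    - intros k. destruct (Ht k). lra.
    - apply (ex_series_le (fun k => PS_decr_n b (S n) k * (1 / 4) ^ k)
               (fun k => / INR (fact (S n)) * (1 / 4) ^ k)); auto.
      intros k. unfold norm; simpl. unfold abs; simpl.
      destruct (Ht k). rewrite Rabs_pos_eq; auto. }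
  assert (T1 : PSeries (PS_decr_n b (S n)) (1 / 4) <= 4 / 3 * / INR (fact (S n))).
  { replace (4 / 3 * / INR (fact (S n))) with
      (Series (fun k => / INR (fact (S n)) * (1 / 4) ^ k)).
    apply Series_le; auto.
    rewrite Series_scal_l, Series_geom by (rewrite Rabs_pos_eq; lra). field.
    apply INR_fact_neq_0. }
  specialize (Hp (S n)). split. nra.
  apply Rplus_le_compat_l. apply Rmult_le_compat_l; lra.
Qed.

Lemma derive_coef_scaled (b : nat -> R) :
  (forall k, 0 <= b k * INR (fact k) <= 1) ->
  forall k, 0 <= PS_derive b k * INR (fact k) <= 1.
Proof.
  intros Hb k. specialize (Hb (S k)). rewrite fact_S_INR in Hb. unfold PS_derive. lra.
Qed.

Ltac eval_quarter H :=
  unfold sum_f_R0, PS_derive, I_coef, K_coef in H; cbn [harmonic] in H;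
  rewrite ?fact_S_INR in H; change (INR (fact 0)) with 1 in H;
  rewrite ?INR_IZR_INZ in H; simpl Z.of_nat in H.

Lemma ISer_quarter : 1.266065876 <= ISer (1 / 4) <= 1.266065879.
Proof.
  pose proof (PSeries_quarter_bounds _ 7 I_coef_scaled) as H.
  revert H. generalize (ISer (1 / 4)). intros v H.
  eval_quarter H. lra.
Qed.

Lemma ISer'_quarter : 1.130318206 <= ISer' (1 / 4) <= 1.130318210.
Proof.
  pose proof (PSeries_quarter_bounds _ 7 (derive_coef_scaled _ I_coef_scaled)) as H.
  revert H. generalize (ISer' (1 / 4)). intros v H.
  eval_quarter H. lra.
Qed.

Lemma KSer_quarter : 0.274247500 <= KSer (1 / 4) <= 0.274247504.
Proof.
  pose proof (PSeries_quarter_bounds _ 7 K_coef_scaled) as H.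
  revert H. generalize (KSer (1 / 4)). intros v H.
  eval_quarter H. lra.
Qed.

Lemma KSer'_quarter : 1.19727779 <= KSer' (1 / 4) <= 1.19727780.
Proof.
  pose proof (PSeries_quarter_bounds _ 7 (derive_coef_scaled _ K_coef_scaled)) as H.
  revert H. generalize (KSer' (1 / 4)). intros v H.
  eval_quarter H. lra.
Qed.

(** At [x = 1] the closed forms are evaluated at [z = 1/4]; writing
    [- (ln (1/2) + gamma)] as the positive number [ln 2 - gamma] makes the
    products monotone in their enclosures. *)
Lemma bessel_values_at_1 :
  1.266065876 <= besselI 0 1 <= 1.266065879 /\
  0.565159103 <= besselI 1 1 <= 0.565159105 /\
  0.421024421 <= besselK 0 1 <= 0.421024455 /\
  0.601907215 <= besselK 1 1 <= 0.601907245.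
Proof.
  destruct ln_2_minus_gamma_bounds as [C1 C2].
  destruct ISer_quarter, ISer'_quarter, KSer_quarter, KSer'_quarter.
  rewrite besselI_0_eq, besselI_1_eq, besselK_0_eq, besselK_1_eq by lra.
  replace ((1 / 2) ^ 2) with (1 / 4) by field.
  replace (ln (1 / 2) + euler_gamma) with (- (ln 2 - euler_gamma)).
  2:{ unfold Rdiv. rewrite Rmult_1_l, ln_Rinv by lra. ring. }
  set (c := ln 2 - euler_gamma) in *.
  set (S := ISer (1 / 4)) in *. set (S' := ISer' (1 / 4)) in *.
  assert (0.115931504 * 1.266065876 <= c * S <= 0.115931526 * 1.266065879)
    by (split; apply Rmult_le_compat; lra).
  assert (0.115931504 * 1.130318206 <= c * S' <= 0.115931526 * 1.130318210)
    by (split; apply Rmult_le_compat; lra).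
  repeat split; lra.
Qed.

(** * Bessel representation of 2-Bell generating functions *)

Theorem theorem3p1 :
  exists P Q : R -> R -> R,
    (forall a : nat -> R, two_bell a ->
       let p := P (a 0%nat) (a 1%nat) in
       let q := Q (a 0%nat) (a 1%nat) in
       let f := fun t : R => p * besselI 0 t + q * besselK 0 t in
       modified_bessel_solution f /\
       is_egf a (fun x => f (exp x)) /\
       (forall p' q' : R,
          is_egf a (fun x => p' * besselI 0 (exp x) + q' * besselK 0 (exp x)) ->
          p' = p /\ q' = q)) /\
    ((P 1 0 = besselK 1 1 /\ approx6 (P 1 0) 0.601907) /\
     (Q 1 0 = besselI 1 1 /\ approx6 (Q 1 0) 0.565159)) /\
    ((P 0 1 = besselK 0 1 /\ approx6 (P 0 1) 0.421024) /\
     (Q 0 1 = - besselI 0 1 /\ approx6 (Q 0 1) (- 1.266066))) /\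
    ((P 1 1 = besselK 0 1 + besselK 1 1 /\ approx6 (P 1 1) 1.022932) /\
     (Q 1 1 = besselI 1 1 - besselI 0 1 /\ approx6 (Q 1 1) (- 0.700907))).
Proof.
  exists (fun a0 a1 => a0 * besselK 1 1 + a1 * besselK 0 1),
         (fun a0 a1 => a0 * besselI 1 1 - a1 * besselI 0 1).
  split.
  - intros a Ha p q f.
    assert (HE : is_egf a (fun x => f (exp x))).
    { intros x. unfold f, p, q. rewrite <- (egf_eq_bessel a Ha x).
      apply PSeries_correct, ex_pseries_entire, egf_coef_entire, Ha. }
    split; [apply modified_bessel_solution_I_K | split; [exact HE |]].
    intros p' q' H'.
    destruct (bessel_pair_independent (p' - p) (q' - q)) as [Ep Eq].
    + intros x. pose proof (is_pseries_unique _ _ _ (HE x)) as E1.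
      pose proof (is_pseries_unique _ _ _ (H' x)) as E2.
      unfold f in E1. rewrite E1 in E2. lra.
    + lra.
  - destruct bessel_values_at_1 as [BI0 [BI1 [BK0 BK1]]].
    repeat split; try ring; unfold approx6; apply Rabs_le; lra.
Qed.
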